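(* Let $\mathcal D$ and $\mathcal D'$ be two $n$-sample datasets that differ at one point. Then $\|\mathbf w(\mathcal D)-\mathbf w(\mathcal D')\|_2$ is bounded as follows, for each of the weighting schemes defined in the context: (1) $O(1)$ for IPW in randomized trials; (2) $O(1)$ for IPW with known regression parameter; (3) $O\big(1\wedge\frac{1}{\lambda_{\min}(\hat\Sigma)+\lambda_{\mathrm{IPW}}}\big)$ for IPW with logistic regression (estimated regression parameter); (4) $O(n/\lambda_{\mathrm{MMD}})$ for MMD weights; (5) $O\big(1\wedge\frac{1}{\lambda_{\min}(\hat\Sigma)+\lambda_{\mathrm{EBW}}}\big)$ for entropy balancing weights (EBW). The constants implied by $O(\cdot)$ do not depend on $n$, on the datasets, or on the regularization coefficients $\lambda_{\mathrm{IPW}},\lambda_{\mathrm{MMD}},\lambda_{\mathrm{EBW}}$; they may depend on the fixed scheme parameters: $p_0,p_1$ in (1); $M,R_{\mathrm{IPW}}$ in (2), (3); $C,R_{\mathrm{MMD}}$ in (4); $R_{\mathrm{EBW}},r_q$ in (5).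
   Context: A dataset is $\mathcal D=(\mathbf x_i,a_i)_{i=1}^n$ with covariates $\mathbf x_i\in\mathbb R^p$ and treatments $a_i\in\{0,1\}$. $a\wedge b=\min\{a,b\}$. All assumptions below are imposed on both $\mathcal D$ and $\mathcal D'$; $\hat\Sigma$ is computed from $\mathcal D$. (1) IPW, randomized trial: treatment probabilities $p_0,p_1\in(0,1)$, $p_0+p_1=1$, fixed; $w_i=n\,p_{a_i}^{-1}/\sum_jp_{a_j}^{-1}$. (2) IPW, known parameter: $\boldsymbol\lambda^*\in\mathbb R^p$ fixed with $\|\boldsymbol\lambda^*\|_2\le R_{\mathrm{IPW}}$, $\|\mathbf x_i\|_2\le M$; $f_i=1+\exp(-(2a_i-1)\langle\mathbf x_i,\boldsymbol\lambda^*\rangle)$, $w_i=nf_i/\sum_jf_j$. (3) IPW, estimated parameter: as in (2) with $\boldsymbol\lambda^*$ replaced by $\hat{\boldsymbol\lambda}=\arg\min_{\|\boldsymbol\lambda\|_2\le R_{\mathrm{IPW}}}\frac1n\sum_i[\log(1+e^{\langle\mathbf x_i,\boldsymbol\lambda\rangle})-a_i\langle\mathbf x_i,\boldsymbol\lambda\rangle]+\frac{\lambda_{\mathrm{IPW}}}2\|\boldsymbol\lambda\|_2^2$, $\lambda_{\mathrm{IPW}}\ge0$, computed from the dataset; $\|\mathbf x_i\|_2\le M$; $\hat\Sigma=\frac1n\sum_i\mathbf x_i\mathbf x_i^\top$ with $\lambda_{\min}(\hat\Sigma)>0$. (4) MMD: $K$ is a reproducing kernel with $|K(\mathbf x_i,\mathbf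 x_j)|\le C$, $\alpha\in[0,1]$, $\lambda_{\mathrm{MMD}}>0$, and $\mathbf w(\mathcal D)=\arg\min_{\mathbf w\in\mathbb R^n,\ \|\mathbf w\|_\infty\le R_{\mathrm{MMD}}}[\mathbf w^\top\mathbf A\mathbf w-2\mathbf w^\top\mathbf b]$, where $\mathbf A_{ij}=\frac1{n^2}(s_{ij}K(\mathbf x_i,\mathbf x_j)+\lambda_{\mathrm{MMD}}\mathbf 1\{i=j\})$ with $s_{ij}=1$ if $a_i=a_j$ and $s_{ij}=\alpha-1$ if $a_i\ne a_j$, and $\mathbf b_i=\frac{\alpha}{n^2}\sum_{j=1}^nK(\mathbf x_i,\mathbf x_j)$. (5) EBW: $n_a=\#\{i:a_i=a\}\ge1$; $\mathbf g=(g_0,\dots,g_K):\mathbb R^p\to\mathbb R^{K+1}$ fixed balance functions ($g_0$ constant); $\mathbf b_i\in\mathbb R^{2(K+1)}$ equals $\frac n{n_0}(\mathbf g(\mathbf x_i),\mathbf 0)$ if $a_i=0$ and $\frac n{n_1}(\mathbf 0,\mathbf g(\mathbf x_i))$ if $a_i=1$, normalized so that $\|\mathbf b_i\|_2\le1$; $\mathbf q=(q_1,\dots,q_n)$ is a fixed probability vector with positive entries, $r_q=\max_iq_i/\min_iq_i$; $\overline{\mathbf g}=\frac1n\sum_i\mathbf g(\mathbf x_i)$; $\hat{\boldsymbol\lambda}=(\hat{\boldsymbol\lambda}_0,\hat{\boldsymbol\lambda}_1)$ maximizes $\langle\boldsymbol\lambda_0+\boldsymbol\lambda_1,\overline{\mathbf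 g}\rangle-\log\sum_iq_ie^{\langle\boldsymbol\lambda,\mathbf b_i\rangle}-\frac{\lambda_{\mathrm{EBW}}}2\|\boldsymbol\lambda\|_2^2$ over $\|\boldsymbol\lambda\|_2\le R_{\mathrm{EBW}}$, with $\lambda_{\mathrm{EBW}}\ge0$; $w_i=nq_ie^{\langle\hat{\boldsymbol\lambda},\mathbf b_i\rangle}/\sum_jq_je^{\langle\hat{\boldsymbol\lambda},\mathbf b_j\rangle}$; $\hat\Sigma=\frac1n\sum_i(\mathbf b_i-\bar{\mathbf b})(\mathbf b_i-\bar{\mathbf b})^\top$ with $\bar{\mathbf b}=\frac1n\sum_i\mathbf b_i$, and $r_q^{-1}e^{-2R_{\mathrm{EBW}}}\lambda_{\min}(\hat\Sigma)+\lambda_{\mathrm{EBW}}>0$. *)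

(* Defs.v *)
From HB Require Import structures.
From mathcomp Require Import all_boot all_order all_algebra.
From mathcomp Require Import all_classical all_reals all_analysis.

Set Implicit Arguments.
Unset Strict Implicit.
Unset Printing Implicit Defensive.
Import Order.TTheory GRing.Theory Num.Theory numFieldNormedType.Exports.
Local Open Scope classical_set_scope.
Local Open Scope ring_scope.

Section Euclidean.
Context {R : realType}.

Definition dot n (u v : 'rV[R]_n) : R := (u *m v^T) 0 0.

(* The library norm `|v| on 'rV[R]_n is the sup norm. *)
Definition norm2 n (u : 'rV[R]_n) : R := Num.sqrt (dot u u).

(* A real symmetric matrix of positive size has finitely many real eigenvalues
   and at least one, so that this infimum is a minimum; it is 0 when n = 0. *)
Definition lambda_min n (A : 'M[R]_n) : R := inf [set t | eigenvalue A t].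

Definition argmin (T : Type) (S : set T) (F : T -> R) : set T :=
  [set x | S x /\ forall y, S y -> F x <= F y].

Definition argmax (T : Type) (S : set T) (F : T -> R) : set T :=
  [set x | S x /\ forall y, S y -> F y <= F x].

Definition ball2 n (r : R) : set 'rV[R]_n := [set u | norm2 u <= r].

End Euclidean.

Section ReproducingKernel.
Context {R : realType} {X : Type}.

(* A real Hilbert space whose elements are functions on X: the inner product ip
   is only meaningful on H. *)
Record hilbert_function_space (H : set (X -> R))
    (ip : (X -> R) -> (X -> R) -> R) : Prop := {
  hfs_zero : H (fun=> 0);
  hfs_lin : forall (t : R) f g, H f -> H g -> H (fun x => t * f x + g x);
  hfs_ip_lin : forall (t : R) f g h, H f -> H g -> H h ->
    ip (fun x => t * f x + g x) h = t * ip f h + ip g h;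
  hfs_ip_sym : forall f g, H f -> H g -> ip f g = ip g f;
  hfs_ip_ge0 : forall f, H f -> 0 <= ip f f;
  hfs_ip_eq0 : forall f, H f -> ip f f = 0 -> f = (fun=> 0);
  hfs_complete : forall u : nat -> X -> R, (forall k, H (u k)) ->
    (forall e : R, 0 < e -> exists N, forall k l, (N <= k)%N -> (N <= l)%N ->
      ip (fun x => u k x - u l x) (fun x => u k x - u l x) < e) ->
    exists2 f, H f &
      (fun k => ip (fun x => u k x - f x) (fun x => u k x - f x)) @ \oo --> (0 : R)
}.

Definition reproducing_kernel (K : X -> X -> R) : Prop :=
  exists (H : set (X -> R)) (ip : (X -> R) -> (X -> R) -> R),
    [/\ hilbert_function_space H ip,
        forall x, H (K x)
      & forall x f, H f -> ip f (K x) = f x].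

End ReproducingKernel.

Section Weights.
Context {R : realType}.

Definition dataset (n p : nat) := 'I_n -> 'rV[R]_p * bool.

Definition covariate n p (D : dataset n p) (i : 'I_n) : 'rV[R]_p := (D i).1.
Definition treatment n p (D : dataset n p) (i : 'I_n) : bool := (D i).2.

Definition differ_at_one_point n p (D D' : dataset n p) : Prop :=
  exists k, D k != D' k /\ forall i, i != k -> D i = D' i.

Definition bounded_covariates n p (M : R) (D : dataset n p) : Prop :=
  forall i, norm2 (covariate D i) <= M.

Definition normalized n (f : 'I_n -> R) : 'rV[R]_n :=
  \row_i (n%:R * f i / \sum_j f j).

Definition ipw_trial n p (p0 p1 : R) (D : dataset n p) : 'rV[R]_n :=
  normalized (fun i => (if treatment D i then p1 else p0)^-1).

Definition ipw n p (lam : 'rV[R]_p) (D : dataset n p) : 'rV[R]_n :=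
  normalized (fun i =>
    1 + expR (- (2 * (treatment D i)%:R - 1) * dot (covariate D i) lam)).

Definition logistic_objective n p (reg : R) (D : dataset n p)
    (lam : 'rV[R]_p) : R :=
  n%:R^-1 * (\sum_i (ln (1 + expR (dot (covariate D i) lam))
                     - (treatment D i)%:R * dot (covariate D i) lam))
  + reg / 2 * norm2 lam ^+ 2.

Definition logistic_estimate n p (Ripw reg : R) (D : dataset n p) :
    set 'rV[R]_p :=
  argmin (@ball2 R p Ripw) (logistic_objective reg D).

Definition second_moment n p (D : dataset n p) : 'M[R]_p :=
  n%:R^-1 *: \sum_i ((covariate D i)^T *m covariate D i).

Definition mmd_matrix n p (K : 'rV[R]_p -> 'rV[R]_p -> R) (alpha reg : R)
    (D : dataset n p) : 'M[R]_n :=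
  \matrix_(i, j) ((n%:R ^+ 2)^-1 *
    ((if treatment D i == treatment D j then 1 else alpha - 1)
       * K (covariate D i) (covariate D j)
     + reg * (i == j)%:R)).

Definition mmd_vector n p (K : 'rV[R]_p -> 'rV[R]_p -> R) (alpha : R)
    (D : dataset n p) : 'rV[R]_n :=
  \row_i (alpha / n%:R ^+ 2 * \sum_j K (covariate D i) (covariate D j)).

Definition mmd_weights n p (K : 'rV[R]_p -> 'rV[R]_p -> R)
    (alpha reg Rmmd : R) (D : dataset n p) : set 'rV[R]_n :=
  argmin [set w : 'rV[R]_n | `|w| <= Rmmd]
    (fun w => dot (w *m mmd_matrix K alpha reg D) w
              - 2 * dot w (mmd_vector K alpha D)).

Definition group_size n p (D : dataset n p) (a : bool) : nat :=
  #|[pred i | treatment D i == a]|.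

Definition balance_vector n p k (g : 'rV[R]_p -> 'rV[R]_k.+1)
    (D : dataset n p) (i : 'I_n) : 'rV[R]_(k.+1 + k.+1) :=
  if treatment D i
  then (n%:R / (group_size D true)%:R) *: row_mx 0 (g (covariate D i))
  else (n%:R / (group_size D false)%:R) *: row_mx (g (covariate D i)) 0.

Definition sample_mean n d (v : 'I_n -> 'rV[R]_d) : 'rV[R]_d :=
  n%:R^-1 *: \sum_i v i.

Definition sample_covariance n d (v : 'I_n -> 'rV[R]_d) : 'M[R]_d :=
  n%:R^-1 *: \sum_i ((v i - sample_mean v)^T *m (v i - sample_mean v)).

Definition positive_probability n (q : 'I_n -> R) : Prop :=
  (forall i, 0 < q i) /\ \sum_i q i = 1.

(* For positive q the maximum is at least every q i, so it is a neutral default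
   value for the minimum. *)
Definition max_min_ratio n (q : 'I_n -> R) : R :=
  let qmax := \big[Num.max/0]_i q i in qmax / \big[Num.min/qmax]_i q i.

Definition ebw_objective n p k (g : 'rV[R]_p -> 'rV[R]_k.+1) (q : 'I_n -> R)
    (reg : R) (D : dataset n p) (lam : 'rV[R]_(k.+1 + k.+1)) : R :=
  dot (lsubmx lam + rsubmx lam) (sample_mean (fun i => g (covariate D i)))
  - ln (\sum_i q i * expR (dot lam (balance_vector g D i)))
  - reg / 2 * norm2 lam ^+ 2.

Definition ebw_estimate n p k (g : 'rV[R]_p -> 'rV[R]_k.+1) (q : 'I_n -> R)
    (Rebw reg : R) (D : dataset n p) : set 'rV[R]_(k.+1 + k.+1) :=
  argmax (@ball2 R _ Rebw) (ebw_objective g q reg D).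

Definition ebw n p k (g : 'rV[R]_p -> 'rV[R]_k.+1) (q : 'I_n -> R)
    (lam : 'rV[R]_(k.+1 + k.+1)) (D : dataset n p) : 'rV[R]_n :=
  normalized (fun i => q i * expR (dot lam (balance_vector g D i))).

(* The normalization of the balance vectors is a hypothesis on g and D: no
   rescaling depending on the data is performed. *)
Definition ebw_assumptions n p k (g : 'rV[R]_p -> 'rV[R]_k.+1)
    (rq Rebw reg : R) (D : dataset n p) : Prop :=
  [/\ forall a, (1 <= group_size D a)%N,
      forall i, norm2 (balance_vector g D i) <= 1
    & 0 < rq^-1 * expR (- 2 * Rebw)
            * lambda_min (sample_covariance (balance_vector g D)) + reg].

End Weights.
Arguments dataset : clear implicits.

(* Main.v *)
Require Import Defs.
From HB Require Import structures.
From mathcomp Require Import all_boot all_order all_algebra.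
From mathcomp Require Import all_classical all_reals all_analysis.
From mathcomp Require Import ring lra.
Import Order.TTheory GRing.Theory Num.Theory numFieldNormedType.Exports.
Local Open Scope classical_set_scope.
Local Open Scope ring_scope.
Set Implicit Arguments.
Unset Strict Implicit.
Unset Printing Implicit Defensive.

(* Weights normalized to have sum n depend Lipschitz-continuously on the
   unnormalized factors, so it is enough to bound the l2 distance of the factors
   up to a common scaling.  When the parameter is fixed only one factor changes.
   When it is estimated, midpoint strong convexity of the objective along the
   line between the two estimates u and v gives
     (c/n) sum_i <x_i, v - u>^2 + reg |v - u|^2 <= (C/n) |v - u|,
   the right-hand side being the effect of one data point.  The first term bounds
   the change of all linear predictors by a constant whatever lambda_min is, and
   the Rayleigh inequality for lambda_min yields the decay in lambda_min + reg.
   For entropy balancing the curvature is that of log-sum-exp, and comes from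
   Lagrange's identity; for MMD the objective is a quadratic form with
   modulus reg / n^2. *)

(** Closeness of the estimates [u] and [v] cannot alone give the decay in [lambda_min + reg]: at the
    replaced point the two predictors use different data, so their difference does not vanish with
    [v - u]. It is bounded by a multiple of |u| + |v| instead. This is small because [u] is also
    compared with the parameter 0, whose objective exceeds that of [u] by at most O(|u|); for [v]
    one uses |v| <= |u| + |v - u|. Hence the square of |u| + |v| stands beside the predictor changes
    in [regularized_decay]. The effect of one data point is always a second difference, in the
    dataset and in the parameter. It thus carries the factor |v - u|; without that factor the rate
    1/(lambda_min + reg) would degrade to its square root. Only the curvature of [D] enters, so only
    its spectrum appears in the bounds. For entropy balancing one replaced point may change both
    group sizes and so rescale every balance vector. The changes still have a bounded sum, since a
    group of size n_a sees a relative change of order 1/n_a. *)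

Section Euclidean.
Context {R : realType}.
Implicit Types n : nat.

(** * Euclidean inner product and norm of row vectors *)

Lemma dotE n (u v : 'rV[R]_n) : dot u v = \sum_i u 0 i * v 0 i.
Proof. by rewrite /dot mxE; apply: eq_bigr => i _; rewrite mxE. Qed.

Lemma dotC n (u v : 'rV[R]_n) : dot u v = dot v u.
Proof. by rewrite !dotE; apply: eq_bigr => i _; rewrite mulrC. Qed.

Lemma dotDl n (u v w : 'rV[R]_n) : dot (u + v) w = dot u w + dot v w.
Proof. by rewrite /dot mulmxDl mxE. Qed.

Lemma dotZl n a (u v : 'rV[R]_n) : dot (a *: u) v = a * dot u v.
Proof. by rewrite /dot -scalemxAl mxE. Qed.

Lemma dotNl n (u v : 'rV[R]_n) : dot (- u) v = - dot u v.
Proof. by rewrite -scaleN1r dotZl mulN1r. Qed.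

Lemma dotBl n (u v w : 'rV[R]_n) : dot (u - v) w = dot u w - dot v w.
Proof. by rewrite dotDl dotNl. Qed.

Lemma dotDr n (u v w : 'rV[R]_n) : dot u (v + w) = dot u v + dot u w.
Proof. by rewrite dotC dotDl !(dotC u). Qed.

Lemma dotZr n a (u v : 'rV[R]_n) : dot u (a *: v) = a * dot u v.
Proof. by rewrite dotC dotZl dotC. Qed.

Lemma dotNr n (u v : 'rV[R]_n) : dot u (- v) = - dot u v.
Proof. by rewrite dotC dotNl dotC. Qed.

Lemma dotBr n (u v w : 'rV[R]_n) : dot u (v - w) = dot u v - dot u w.
Proof. by rewrite dotDr dotNr. Qed.

Lemma dot0r n (u : 'rV[R]_n) : dot u 0 = 0.
Proof. by rewrite -(scale0r u) dotZr mul0r. Qed.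

Lemma dot0l n (u : 'rV[R]_n) : dot 0 u = 0.
Proof. by rewrite dotC dot0r. Qed.

Lemma dot_sumr n (I : finType) (P : pred I) (u : 'rV[R]_n) (v : I -> 'rV[R]_n) :
  dot u (\sum_(i | P i) v i) = \sum_(i | P i) dot u (v i).
Proof.
by apply: (big_morph (dot u)) => [x y|]; rewrite ?dotDr ?dot0r.
Qed.

Lemma dot_ge0 n (u : 'rV[R]_n) : 0 <= dot u u.
Proof. by rewrite dotE sumr_ge0// => i _; rewrite -expr2 sqr_ge0. Qed.

Lemma dot_eq0 n (u : 'rV[R]_n) : dot u u = 0 -> u = 0.
Proof.
rewrite dotE => /eqP; rewrite psumr_eq0; last first.
  by move=> i _; rewrite -expr2 sqr_ge0.
move=> /allP u0; apply/rowP => i; rewrite mxE.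
by have := u0 i (mem_index_enum _); rewrite /= -expr2 sqrf_eq0 => /eqP.
Qed.

Lemma norm2_ge0 n (u : 'rV[R]_n) : 0 <= norm2 u.
Proof. exact: sqrtr_ge0. Qed.

Lemma sqr_norm2 n (u : 'rV[R]_n) : norm2 u ^+ 2 = dot u u.
Proof. by rewrite sqr_sqrtr// dot_ge0. Qed.

Lemma norm2_sqr_le n (u : 'rV[R]_n) c :
  0 <= c -> dot u u <= c ^+ 2 -> norm2 u <= c.
Proof.
by move=> c0; rewrite -sqr_norm2 ler_sqr// nnegrE norm2_ge0.
Qed.

Lemma norm20 n : norm2 (0 : 'rV[R]_n) = 0.
Proof. by rewrite /norm2 dot0r sqrtr0. Qed.

Lemma norm2N n (u : 'rV[R]_n) : norm2 (- u) = norm2 u.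
Proof. by rewrite /norm2 dotNl dotNr opprK. Qed.

Lemma norm2Z n a (u : 'rV[R]_n) : norm2 (a *: u) = `|a| * norm2 u.
Proof. by rewrite /norm2 dotZl dotZr mulrA -expr2 sqrtrM ?sqr_ge0// sqrtr_sqr. Qed.

Lemma Cauchy_Schwarz n (u v : 'rV[R]_n) : `|dot u v| <= norm2 u * norm2 v.
Proof.
suff h : dot u v ^+ 2 <= dot u u * dot v v.
  rewrite -ler_sqr ?nnegrE ?mulr_ge0 ?norm2_ge0//.
  by rewrite exprMn !sqr_norm2 real_normK// num_real.
have [v0|v0] := eqVneq (dot v v) 0.
  by rewrite (dot_eq0 v0) !dot0r mulr0 expr0n.
have vp : 0 < dot v v by rewrite lt_neqAle eq_sym v0 dot_ge0.
have := dot_ge0 (dot v v *: u - dot u v *: v).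
rewrite dotBl !dotBr !dotZl !dotZr (dotC v u) => h.
have : 0 <= dot v v * (dot u u * dot v v - dot u v ^+ 2) by lra.
by rewrite pmulr_rge0// subr_ge0.
Qed.

Lemma norm2D n (u v : 'rV[R]_n) : norm2 (u + v) <= norm2 u + norm2 v.
Proof.
apply: norm2_sqr_le; first by rewrite addr_ge0 ?norm2_ge0.
rewrite dotDl !dotDr (dotC v u) sqrrD !sqr_norm2.
have := le_trans (ler_norm _) (Cauchy_Schwarz u v); lra.
Qed.

Lemma norm2B n (u v : 'rV[R]_n) : norm2 (u - v) <= norm2 u + norm2 v.
Proof. by rewrite -(norm2N v) norm2D. Qed.

Lemma norm2_sum n (I : finType) (v : I -> 'rV[R]_n) :
  norm2 (\sum_i v i) <= \sum_i norm2 (v i).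
Proof.
apply: (big_ind2 (fun x y => norm2 x <= y)) => //; first by rewrite norm20.
by move=> x1 x2 y1 y2 h1 h2; rewrite (le_trans (norm2D _ _))// lerD.
Qed.

Lemma dot_bound n (u v : 'rV[R]_n) a b :
  norm2 u <= a -> norm2 v <= b -> `|dot u v| <= a * b.
Proof.
by move=> ua vb; rewrite (le_trans (Cauchy_Schwarz u v))// ler_pM ?norm2_ge0.
Qed.

Lemma dot_row_mx m n (u : 'rV[R]_(m + n)) (v : 'rV[R]_m) (w : 'rV[R]_n) :
  dot u (row_mx v w) = dot (lsubmx u) v + dot (rsubmx u) w.
Proof.
by rewrite -{1}(hsubmxK u) /dot tr_row_mx mul_row_col mxE.
Qed.

Lemma norm2_row_mx m n (v : 'rV[R]_m) (w : 'rV[R]_n) :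
  norm2 (row_mx v w) ^+ 2 = norm2 v ^+ 2 + norm2 w ^+ 2.
Proof. by rewrite !sqr_norm2 dot_row_mx row_mxKl row_mxKr. Qed.

Lemma dot_mulmxE n (A : 'M[R]_n) (u v : 'rV[R]_n) :
  dot (u *m A) v = \sum_i \sum_j u 0 i * A i j * v 0 j.
Proof.
rewrite dotE exchange_big; apply: eq_bigr => j _.
by rewrite mxE mulr_suml.
Qed.

Lemma dot_mulmxC n (A : 'M[R]_n) (u v : 'rV[R]_n) :
  A^T = A -> dot (u *m A) v = dot (v *m A) u.
Proof.
by move=> As; rewrite [RHS]dotC /dot trmx_mul As mulmxA.
Qed.

(** Cauchy-Schwarz against the constant vector, from [2 a_i a_j <= a_i^2 + a_j^2] summed over all
    pairs. *)
Lemma sqr_sum_le (I : finType) (a : I -> R) :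
  (\sum_i a i) ^+ 2 <= #|I|%:R * \sum_i a i ^+ 2.
Proof.
have sumc (x : R) : \sum_(i : I) x = #|I|%:R * x by rewrite sumr_const mulr_natl.
have <- : \sum_i \sum_j (a i ^+ 2 + a j ^+ 2) / 2 = #|I|%:R * \sum_i a i ^+ 2.
  under eq_bigr do rewrite -mulr_suml big_split/= sumc.
  by rewrite -mulr_suml big_split/= sumc -mulr_sumr; field.
rewrite expr2 mulr_suml ler_sum// => i _; rewrite mulr_sumr ler_sum// => j _.
have := sqr_ge0 (a i - a j); lra.
Qed.

Lemma sumr_ord n (c : R) : \sum_(i < n) c = n%:R * c.
Proof. by rewrite sumr_const card_ord mulr_natl. Qed.

Lemma norm2_le_card n (u : 'rV[R]_n) b : (forall i, `|u 0 i| <= b) ->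
  norm2 u ^+ 2 <= n%:R * b ^+ 2.
Proof.
move=> ub; rewrite sqr_norm2 dotE.
apply: (@le_trans _ _ (\sum_(i < n) b ^+ 2)).
  apply: ler_sum => i _; have := ub i; rewrite -expr2 -(real_normK (num_real (u 0 i))).
  by move=> h; rewrite ler_sqr// nnegrE (le_trans _ h).
by rewrite sumr_ord.
Qed.

End Euclidean.

(** * The Rayleigh inequality for the least eigenvalue *)

Section Rayleigh.
Context {R : realType}.

Lemma dot_continuous n (A : 'M[R]_n) : continuous (fun u : 'rV[R]_n => dot (u *m A) u).
Proof.
under eq_fun do rewrite dot_mulmxE.
have ac : continuous (fun x : R * R => x.1 + x.2).
  by move=> x; apply: cvgD; [exact: cvg_fst | exact: cvg_snd].
apply: (continuous_big ac) => i _; apply: (continuous_big ac) => j _ x.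
have coord l : (fun u : 'rV[R]_n => u 0 l) y @[y --> x] --> x 0 l.
  exact: (@coord_continuous R).
exact: (cvgM (cvgM (coord i) (cvg_cst (A i j))) (coord j)).
Qed.

(** Extreme value theorem on the unit sphere, which is closed, bounded, and nonempty because the
    size is positive. *)
Lemma symmetric_form_min n (A : 'M[R]_n.+1) : exists2 v : 'rV[R]_n.+1,
  dot v v = 1 & forall u, dot u u = 1 -> dot (v *m A) v <= dot (u *m A) u.
Proof.
pose S := [set u : 'rV[R]_n.+1 | dot u u = 1].
have dc : continuous (fun u : 'rV[R]_n.+1 => dot u u).
  rewrite (_ : (fun u => _) = (fun u => dot (u *m 1%:M) u)); first exact: dot_continuous.
  by apply/funext => u; rewrite mulmx1.
have [|||u Su um] := @EVT_min_rV R n.+1 (fun u => dot (u *m A) u) S.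
- exists (delta_mx 0 0); rewrite /S/= dotE big_ord_recl big1 => [|i _]; rewrite !mxE ?mul0r//.
  by rewrite !eqxx mulr1 addr0.
- apply: bounded_closed_compact.
    exists 1; split; first exact: num_real.
    move=> M M1 u /= u1; rewrite [leLHS]/Num.Def.normr/= mx_normrE bigmax_le ?(le_trans ler01 (ltW M1))//.
    move=> [i j] _ /=; rewrite (ord1 i) (le_trans _ (ltW M1))//.
    rewrite -ler_sqr ?nnegrE// real_normK ?num_real// expr1n -u1 dotE (bigD1 j)//= -expr2.
    by rewrite lerDl sumr_ge0// => k _; rewrite -expr2 sqr_ge0.
  have -> : S = (fun u => dot u u) @^-1` [set 1] by [].
  by apply: closed_comp => //= x _; exact: dc.
- exact/continuous_subspaceT/dot_continuous.
- exists u => //; first by move: Su; rewrite inE.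
  by move=> w w1; apply: um; rewrite inE.
Qed.

(* A minimizer v of the quadratic form on the unit sphere, with minimum t, is
   in the kernel of the positive semidefinite form A - t, so that t is an
   eigenvalue of A. *)
Lemma lambda_min_le n (A : 'M[R]_n) (u : 'rV[R]_n) : A^T = A ->
  lambda_min A * norm2 u ^+ 2 <= dot (u *m A) u.
Proof.
case: n A u => [|n] A u As.
  by rewrite sqr_norm2 !dotE !big_ord0 mulr0.
have [v v1 vmin] := symmetric_form_min A.
set t := dot (v *m A) v in vmin.
(* Homogeneity carries the minimum on the sphere over to all vectors, so that [v + s *: w] can be
   tested below without normalizing it. *)
have ge_t w : t * dot w w <= dot (w *m A) w.
  have [w0|w0] := eqVneq (dot w w) 0.
    by rewrite (dot_eq0 w0) mul0mx !dot0r mulr0.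
  have wp : 0 < norm2 w by rewrite sqrtr_gt0 lt_neqAle eq_sym w0 dot_ge0.
  have := vmin ((norm2 w)^-1 *: w).
  rewrite -scalemxAl !dotZl !dotZr -(sqr_norm2 w).
  have -> : (norm2 w)^-1 * ((norm2 w)^-1 * norm2 w ^+ 2) = 1 by field; rewrite gt_eqF.
  by move=> /(_ erefl); rewrite mulrA -invfM -expr2 ler_pdivlMl ?exprn_gt0// mulrC.
have vA : v *m A = t *: v.
  apply/eqP; rewrite -subr_eq0; apply/eqP/dot_eq0.
  set w := v *m A - t *: v.
  have wE : dot w w = dot (w *m A) v - t * dot w v.
    by rewrite [in RHS](dot_mulmxC _ _ As) (dotC w v) -dotZl -dotBl.
  clearbody w; pose c := dot (w *m A) w - t * dot w w.
  have c0 : 0 <= c by rewrite subr_ge0.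
  have H s : 0 <= 2 * s * dot w w + s ^+ 2 * c.
    have := ge_t (v + s *: w).
    rewrite mulmxDl -scalemxAl !dotDl !dotDr !dotZl !dotZr v1 (dotC v w).
    rewrite (dot_mulmxC v w As) -/t /c wE; lra.
  (* The quadratic in [s] of [H] has slope [2 * dot w w] at 0, so it is negative for a suitable
     [s < 0] unless [w = 0]. Dividing by [c + 1] rather than [c] covers [c = 0]. *)
  have := H (- dot w w / (c + 1)).
  have c1 : 0 < c + 1 by lra.
  have -> : 2 * (- dot w w / (c + 1)) * dot w w + (- dot w w / (c + 1)) ^+ 2 * c =
    - (dot w w ^+ 2 * ((c + 2) / (c + 1) ^+ 2)).
    by field; rewrite gt_eqF.
  rewrite oppr_ge0 pmulr_lle0 ?divr_gt0 ?exprn_gt0//; last by lra.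
  by move=> h; apply/eqP; rewrite -sqrf_eq0 eq_le h sqr_ge0.
rewrite sqr_norm2 (le_trans _ (ge_t u))// ler_wpM2r ?dot_ge0//.
apply: ge_inf; last first.
  apply/eigenvalueP; exists v => //; apply: contra_eq_neq v1 => ->.
  by rewrite dot0r eq_sym oner_neq0.
exists t => a /eigenvalueP[w wA w0].
have wp : 0 < dot w w.
  rewrite lt_neqAle dot_ge0 andbT eq_sym.
  by apply: contra w0 => /eqP/dot_eq0 ->.
by have := ge_t w; rewrite wA dotZl ler_pM2r.
Qed.

Lemma lambda_min_ge0 n (A : 'M[R]_n) :
  (forall u, 0 <= dot (u *m A) u) -> 0 <= lambda_min A.
Proof.
move=> A0; rewrite /lambda_min; set S := [set t | _].
(* Without a real eigenvalue [lambda_min] is 0, the value of [inf] on the empty set. *)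
have [->|/set0P S0] := eqVneq S set0; first by rewrite inf0.
apply: lb_le_inf => // a /eigenvalueP[w wA w0].
have wp : 0 < dot w w.
  rewrite lt_neqAle dot_ge0 andbT eq_sym.
  by apply: contra w0 => /eqP/dot_eq0 ->.
by have := A0 w; rewrite wA dotZl pmulr_lge0.
Qed.

End Rayleigh.

(** * Tools common to all schemes: exponentials, midpoints, normalization, decay *)

Section Stability.
Context {R : realType}.

(** The tangent inequality [1 + x <= expR x] at [x = a - b] replaces the mean value theorem; the
    lower bound that follows uses it at [b - a]. *)
Lemma expR_lip_le (B a b : R) : a <= B -> b <= B ->
  `|expR a - expR b| <= expR B * `|a - b|.
Proof.
wlog ab : a b / a <= b => [hw|] aB bB.
  have [/hw->//|/ltW/hw] := leP a b.
  by rewrite distrC (distrC a); exact.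
rewrite ler0_norm ?subr_le0 ?ler_expR// ler0_norm ?subr_le0// !opprB.
apply: (@le_trans _ _ (expR b * (b - a))).
  have := expR_ge1Dx (a - b); rewrite expRB ler_pdivlMr ?expR_gt0//; lra.
by rewrite ler_wpM2r ?subr_ge0// ler_expR.
Qed.

Lemma expR_lip_ge (B a b : R) : - B <= a -> - B <= b ->
  expR (- B) * `|a - b| <= `|expR a - expR b|.
Proof.
wlog ab : a b / a <= b => [hw|] aB bB.
  have [/hw->//|/ltW/hw] := leP a b.
  by rewrite distrC (distrC (expR _)); exact.
rewrite ler0_norm ?subr_le0// [leRHS]ler0_norm ?subr_le0 ?ler_expR// !opprB.
apply: (@le_trans _ _ (expR a * (b - a))).
  by rewrite ler_wpM2r ?subr_ge0// ler_expR.
have := expR_ge1Dx (b - a); rewrite expRB ler_pdivlMr ?expR_gt0//; lra.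
Qed.

Lemma ln_le_subr1 (x : R) : 0 < x -> ln x <= x - 1.
Proof. by move=> x0; rewrite -{1}(subrKC 1 x) le_ln1Dx//; lra. Qed.

(** Taken with [x] a product of endpoint values and [y] the square of the midpoint value, it turns
    midpoint convexity of a logarithm into an algebraic identity for [x - y]. *)
Lemma ln_gap (x y : R) : 0 < x -> 0 < y -> 1 - y / x <= ln x - ln y.
Proof.
move=> x0 y0; have := ln_le_subr1 (divr_gt0 y0 x0).
rewrite ln_div ?posrE//; lra.
Qed.

(** The parallelogram law; the last term is the strong convexity of the ridge penalty. *)
Lemma norm2_midpoint n (u v : 'rV[R]_n) :
  norm2 (2^-1 *: (u + v)) ^+ 2 =
  (norm2 u ^+ 2 + norm2 v ^+ 2) / 2 - norm2 (v - u) ^+ 2 / 4.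
Proof.
rewrite !sqr_norm2 !(dotZl, dotZr, dotBl, dotBr, dotDl, dotDr) (dotC v u).
by field.
Qed.

Lemma ball2_midpoint n (r : R) (u v : 'rV[R]_n) :
  ball2 r u -> ball2 r v -> ball2 r (2^-1 *: (u + v)).
Proof.
rewrite /ball2/= norm2Z ger0_norm ?invr_ge0// => ur vr.
have := norm2D u v; lra.
Qed.

(** A derivative-free optimality condition, valid also at the boundary of the constraint set as long
    as the midpoint stays feasible. *)
Lemma argmin_midpoint n (S : set 'rV[R]_n) (F : 'rV[R]_n -> R) u v q :
  argmin S F u -> S (2^-1 *: (u + v)) ->
  F (2^-1 *: (u + v)) <= (F u + F v) / 2 - q -> 2 * q <= F v - F u.
Proof. by move=> [_ uF] /uF; lra. Qed.

Lemma normalizedZ n (f : 'I_n -> R) a : a != 0 ->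
  normalized (fun i => a * f i) = normalized f.
Proof.
move=> a0; apply/rowP => i; rewrite !mxE -mulr_sumr invfM.
by move: (\sum_j _)^-1 => S; field.
Qed.

(** The sum of the factors moves by at most [sqrt n * E] and the vector [f'] has norm at most
    [sqrt n * B]; the two losses cancel against the normalizing sum, which is at least [n * m]. The
    constant is therefore free of [n]. *)
Lemma normalized_lip n (f f' : 'I_n -> R) m B E :
  (0 < n)%N -> 0 < m -> 0 <= E ->
  (forall i, m <= f i) -> (forall i, m <= f' i) -> (forall i, f' i <= B) ->
  \sum_i (f i - f' i) ^+ 2 <= E ^+ 2 ->
  norm2 (normalized f - normalized f') <= (m^-1 + B / m ^+ 2) * E.
Proof.
move=> n0 m0 E0 fm f'm f'B dE.
pose s : R := Num.sqrt n%:R.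
have np : 0 < n%:R :> R by rewrite ltr0n.
have sp : 0 < s by rewrite sqrtr_gt0.
have s2 : s ^+ 2 = n%:R by rewrite sqr_sqrtr ?ltW.
have sumge g : (forall i, m <= g i) -> n%:R * m <= \sum_(i < n) g i.
  by move=> gm; rewrite -sumr_ord ler_sum.
pose S := \sum_i f i; pose S' := \sum_i f' i.
have nm : 0 < n%:R * m by rewrite mulr_gt0.
have Sm : n%:R * m <= S by exact: sumge.
have S'm : n%:R * m <= S' by exact: sumge.
have Sp : 0 < S by exact: lt_le_trans Sm.
have S'p : 0 < S' by exact: lt_le_trans S'm.
have B0 : 0 <= B by rewrite (le_trans (ltW m0))// (le_trans (f'm (Ordinal n0))).
pose d := \row_i (f i - f' i); pose F' := \row_i f' i.
have -> : normalized f - normalized f' =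
    (n%:R / S) *: d + (n%:R / S * ((S' - S) / S')) *: F'.
  apply/rowP => i; rewrite !mxE -/S -/S'.
  by field; rewrite !gt_eqF.
have dE' : norm2 d <= E.
  apply: norm2_sqr_le => //; rewrite dotE; apply: le_trans dE.
  by apply: ler_sum => i _; rewrite mxE expr2.
have F'B : norm2 F' <= s * B.
  rewrite -ler_sqr ?nnegrE ?norm2_ge0 ?mulr_ge0 ?(ltW sp)// exprMn s2.
  apply: norm2_le_card => i; rewrite mxE ger0_norm// (le_trans (ltW m0))//.
have SE : `|S' - S| <= s * E.
  rewrite -ler_sqr ?nnegrE ?mulr_ge0 ?(ltW sp)// exprMn s2.
  rewrite real_normK ?num_real// -sqrrN opprB -sumrB.
  apply: le_trans (sqr_sum_le _) _; rewrite card_ord.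
  by rewrite ler_pM2l.
have nS : n%:R / S <= m^-1 by rewrite ler_pdivrMr// ler_pdivlMl// mulrC.
have nS' : n%:R / S' <= m^-1 by rewrite ler_pdivrMr// ler_pdivlMl// mulrC.
apply: le_trans (norm2D _ _) _; rewrite !norm2Z [leRHS]mulrDl; apply: lerD.
  rewrite ger0_norm; last by rewrite divr_ge0 ?ltW.
  by rewrite ler_pM ?norm2_ge0// divr_ge0 ?ltW.
rewrite !normrM ger0_norm; last by rewrite ltW.
rewrite ger0_norm; last by rewrite invr_ge0 ltW.
rewrite [`|S'^-1|]ger0_norm; last by rewrite invr_ge0 ltW.
apply: (@le_trans _ _ (m^-1 * (s * E / S') * (s * B))).
  rewrite ler_pM ?norm2_ge0// ?mulr_ge0 ?divr_ge0 ?normr_ge0 ?invr_ge0 ?(ltW Sp) ?(ltW S'p)//.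
  rewrite ler_pM ?mulr_ge0 ?divr_ge0 ?normr_ge0 ?invr_ge0 ?(ltW Sp) ?(ltW S'p)//.
  by rewrite ler_wpM2r ?invr_ge0 ?(ltW S'p).
have -> : m^-1 * (s * E / S') * (s * B) = m^-1 * (n%:R / S') * (B * E).
  by rewrite -s2; field; rewrite !gt_eqF.
have -> : B / m ^+ 2 * E = m^-1 * m^-1 * (B * E) by field; rewrite gt_eqF.
by rewrite ler_wpM2r ?mulr_ge0// ler_wpM2l ?invr_ge0 ?(ltW m0).
Qed.

(** With [K = C / c0], the first two terms are the bound without decay: [2 r K] for the predictors
    and [(2 r)^2] for the parameters. The last one is the bound with decay: [L] for the predictors
    and [9 = 3^2] for the parameters. *)
Definition decay_const (c0 C L r : R) : R :=
  2 * r * C / c0 + 4 * r ^+ 2 + (`|L| + 9) * (C / c0) ^+ 2.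

Lemma decay_const_ge0 (c0 C L r : R) : 0 <= c0 -> 0 <= C -> 0 <= r ->
  0 <= decay_const c0 C L r.
Proof.
move=> c00 C0 r0; rewrite /decay_const.
have h1 : 0 <= 2 * r * C / c0 by rewrite divr_ge0// !mulr_ge0.
have h2 : 0 <= (`|L| + 9) * (C / c0) ^+ 2 by rewrite mulr_ge0 ?sqr_ge0 ?addr_ge0.
by have := sqr_ge0 r; lra.
Qed.

(* V is the squared change of the linear predictors, H the change of the
   parameter, and a, a' the norms of the two parameters.  The bound on
   [c0 / N * V + reg * H ^+ 2] gives both [V <= C H / c0], hence a bound without
   regularization, and [H <= C / (c0 N (l + reg))], hence the decay. *)
Lemma regularized_decay (N c0 C L r l reg V H a a' : R) :
  1 <= N -> 0 < c0 <= 1 -> 0 <= C -> 0 <= l -> 0 <= reg -> 0 < l + reg ->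
  0 <= V -> 0 <= H -> 0 <= a <= r -> 0 <= a' <= r -> H <= a + a' -> a' <= a + H ->
  c0 / N * V + reg * H ^+ 2 <= C / N * H ->
  N * l * H ^+ 2 <= V -> V <= N * L * H ^+ 2 ->
  c0 * l * a ^+ 2 + reg * a ^+ 2 <= C * a ->
  V + (a + a') ^+ 2 <= decay_const c0 C L r * Num.min 1 (1 / (l + reg)) ^+ 2.
Proof.
rewrite /decay_const.
move=> N1 /andP[c00 c01] C0 l0 reg0 mu0 V0 H0 /andP[a0 ar] /andP[a'0 a'r] Haa a'aH h1 h2 h3 h4.
set mu := l + reg in mu0 *; set K := C / c0.
have N0 : 0 < N by exact: lt_le_trans N1.
have K0 : 0 <= K by rewrite divr_ge0 ?(ltW c00).
have r0 : 0 <= r by exact: le_trans ar.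
have CK : C = c0 * K by rewrite /K; field; rewrite gt_eqF.
have VH : V <= K * H.
  have : c0 / N * V <= C / N * H by have := mulr_ge0 reg0 (sqr_ge0 H); lra.
  rewrite (_ : C / N * H = c0 / N * (K * H)); last by rewrite CK; ring.
  by rewrite ler_pM2l// divr_gt0.
have muH : N * mu * H <= K.
  have [->|Hn0] := eqVneq H 0; first by rewrite mulr0.
  have Hp : 0 < H by rewrite lt_neqAle eq_sym Hn0.
  (* As [c0 <= 1], the data curvature [c0 * l] and [reg] together dominate [c0 * (l + reg)]. *)
  have e : c0 * mu * H ^+ 2 <= C / N * H.
    apply: le_trans h1.
    have -> : c0 * mu * H ^+ 2 = c0 / N * (N * l * H ^+ 2) + c0 * (reg * H ^+ 2).
      by rewrite /mu; field; rewrite gt_eqF.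
    rewrite lerD// ?ler_wpM2l ?divr_ge0 ?(ltW c00) ?(ltW N0)//.
    by rewrite ler_piMl// mulr_ge0// sqr_ge0.
  have ch : 0 < c0 / N * H by rewrite mulr_gt0// divr_gt0.
  rewrite -(ler_pM2l ch) (_ : _ * K = C / N * H); last by rewrite CK; ring.
  by rewrite (_ : _ * (N * mu * H) = c0 * mu * H ^+ 2)//; field; rewrite gt_eqF.
have mua : mu * a <= K.
  have [->|an0] := eqVneq a 0; first by rewrite mulr0.
  have ap : 0 < a by rewrite lt_neqAle eq_sym an0.
  have e : c0 * mu * a ^+ 2 <= C * a.
    apply: le_trans h4; rewrite /mu.
    have := ler_wpM2r (mulr_ge0 reg0 (sqr_ge0 a)) c01; lra.
  by move: e; rewrite CK expr2 mulrA ler_pM2r// -!mulrA ler_pM2l.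
have muH1 : mu * H <= K.
  apply: le_trans muH; rewrite -mulrA ler_peMl// mulr_ge0// ltW//.
have B1 : V + (a + a') ^+ 2 <= 2 * r * K + 4 * r ^+ 2.
  apply: lerD; last first.
    have h : a + a' <= 2 * r by lra.
    have : (a + a') ^+ 2 <= (2 * r) ^+ 2 by rewrite ler_sqr// nnegrE ?addr_ge0 ?mulr_ge0.
    lra.
  apply: le_trans VH _; rewrite mulrC ler_wpM2r//; lra.
have B2 : mu ^+ 2 * (V + (a + a') ^+ 2) <= (`|L| + 9) * K ^+ 2.
  rewrite mulrDr mulrDl; apply: lerD; last first.
    (* From [a + a' <= 2 * a + H], where [mu * a] and [mu * H] are each at most [K]. *)
    have h : mu * (a + a') <= 3 * K.
      have := ler_wpM2l (ltW mu0) a'aH; rewrite !mulrDr; lra.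
    have : (mu * (a + a')) ^+ 2 <= (3 * K) ^+ 2.
      by rewrite ler_sqr// nnegrE mulr_ge0// ?addr_ge0 ?(ltW mu0).
    lra.
  apply: (@le_trans _ _ (mu ^+ 2 * (N * `|L| * H ^+ 2))).
    rewrite ler_wpM2l ?sqr_ge0// (le_trans h3)// ler_wpM2r ?sqr_ge0//.
    by rewrite ler_wpM2l ?(ltW N0)// ler_norm.
  (* The factor [N] is absorbed by one copy of [H], through [N * mu * H <= K]. *)
  have -> : mu ^+ 2 * (N * `|L| * H ^+ 2) = `|L| * ((N * mu * H) * (mu * H)) by ring.
  by rewrite ler_wpM2l// expr2 ler_pM// ?mulr_ge0 ?(ltW mu0) ?(ltW N0).
have [P0 Q0] : 0 <= 2 * r * K + 4 * r ^+ 2 /\ 0 <= (`|L| + 9) * K ^+ 2.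
  have [rK KK] := (mulr_ge0 r0 K0, sqr_ge0 K); have rr := sqr_ge0 r.
  by split; [lra | rewrite mulr_ge0// addr_ge0].
have -> : 2 * r * C / c0 = 2 * r * K by rewrite /K mulrA.
have [_|_] := leP 1 (1 / mu); first by rewrite expr1n mulr1; lra.
rewrite mul1r -ler_pdivrMr ?exprn_gt0 ?invr_gt0// exprVn invrK mulrC; lra.
Qed.

End Stability.

(** * Inverse probability weights and the logistic objective *)

Section InverseProbability.
Context {R : realType}.

Lemma dot_gram n d c (x : 'I_n -> 'rV[R]_d) (u : 'rV[R]_d) :
  dot (u *m (c *: \sum_i ((x i)^T *m x i))) u = c * \sum_i dot (x i) u ^+ 2.
Proof.
rewrite -scalemxAr dotZl mulmx_sumr dotC dot_sumr; congr (_ * _).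
apply: eq_bigr => i _; rewrite mulmxA (mx11_scalar (u *m (x i)^T)) mul_scalar_mx.
by rewrite dotZr -/(dot u (x i)) (dotC u) expr2.
Qed.

Lemma gram_sym n d c (x : 'I_n -> 'rV[R]_d) :
  (c *: \sum_i ((x i)^T *m x i))^T = c *: \sum_i ((x i)^T *m x i).
Proof.
rewrite linearZ/= raddf_sum/=; congr (_ *: _); apply: eq_bigr => i _.
by rewrite trmx_mul trmxK.
Qed.

Lemma lambda_min_gram n d (x : 'I_n -> 'rV[R]_d) (u : 'rV[R]_d) : (0 < n)%N ->
  n%:R * lambda_min (n%:R^-1 *: \sum_i ((x i)^T *m x i)) * norm2 u ^+ 2 <=
  \sum_i dot (x i) u ^+ 2.
Proof.
move=> n0; rewrite -mulrA -ler_pdivlMl ?ltr0n//.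
by rewrite -(dot_gram _ x) lambda_min_le// gram_sym.
Qed.

Lemma sum_sqr_dot_le n d (x : 'I_n -> 'rV[R]_d) (u : 'rV[R]_d) M :
  (forall i, norm2 (x i) <= M) ->
  \sum_i dot (x i) u ^+ 2 <= n%:R * M ^+ 2 * norm2 u ^+ 2.
Proof.
move=> xM; rewrite -mulrA -exprMn -sumr_ord.
apply: ler_sum => i _; rewrite -(real_normK (num_real _)).
have h := dot_bound (xM i) (lexx (norm2 u)).
by rewrite ler_sqr// nnegrE (le_trans _ h).
Qed.

Lemma sum_one_point n k (f : 'I_n -> R) :
  (forall i, i != k -> f i = 0) -> \sum_i f i = f k.
Proof. by move=> f0; rewrite (bigD1 k)//= big1 ?addr0. Qed.

Lemma one_point_size n p (D D' : dataset R n p) :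
  differ_at_one_point D D' -> (0 < n)%N.
Proof. by case=> k _; exact: leq_ltn_trans (ltn_ord k). Qed.

Lemma normalized_one_point n (f f' : 'I_n -> R) k B :
  (forall i, i != k -> f i = f' i) ->
  (forall i, 1 <= f i <= B) -> (forall i, 1 <= f' i <= B) ->
  norm2 (normalized f - normalized f') <= (1 + B) * B.
Proof.
move=> ff' fB f'B; have /andP[f1 fkB] := fB k; have /andP[f'1 f'kB] := f'B k.
(* Puts the constant in the form of [normalized_lip] with lower bound 1 and distance [E = B]: only
   one factor moves, inside an interval of length less than [B]. *)
rewrite -[1 in leRHS]invr1 -[B in (1^-1 + B) * _]divr1 -[X in B / X](expr1n _ 2).
apply: normalized_lip => //; try by [lra | move=> i; have := fB i; have := f'B i; lra].
  exact: leq_ltn_trans (ltn_ord k).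
rewrite (@sum_one_point _ k); last by move=> i /ff' ->; rewrite subrr expr0n.
rewrite -(real_normK (num_real _)) ler_sqr ?nnegrE//; last lra.
rewrite ler_norml; lra.
Qed.

Lemma ipw_trial_stable n p (p0 p1 : R) (D D' : dataset R n p) :
  0 < p0 < 1 -> 0 < p1 < 1 -> differ_at_one_point D D' ->
  norm2 (ipw_trial p0 p1 D - ipw_trial p0 p1 D') <=
  (1 + (p0^-1 + p1^-1)) * (p0^-1 + p1^-1).
Proof.
move=> /andP[p00 p01] /andP[p10 p11] [k [_ DD']].
have i0 : 1 <= p0^-1 by rewrite invf_ge1// ltW.
have i1 : 1 <= p1^-1 by rewrite invf_ge1// ltW.
apply: (@normalized_one_point _ _ _ k).
- by move=> i /DD'; rewrite /treatment => ->.
- by move=> i; case: ifP => _; lra.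
- by move=> i; case: ifP => _; lra.
Qed.

Definition ipw_exponent n p (lam : 'rV[R]_p) (D : dataset R n p) i : R :=
  - (2 * (treatment D i)%:R - 1) * dot (covariate D i) lam.

Lemma norm_ipw_exponent n p (lam : 'rV[R]_p) (D : dataset R n p) i :
  `|ipw_exponent lam D i| = `|dot (covariate D i) lam|.
Proof.
rewrite /ipw_exponent normrM normrN; case: treatment; rewrite /= ?mulr1 ?mulr0.
  by rewrite (_ : 2 - 1 = 1) ?normr1 ?mul1r//; ring.
by rewrite sub0r normrN1 mul1r.
Qed.

Lemma ipw_factor_bounds n p (lam : 'rV[R]_p) (D : dataset R n p) M r i :
  norm2 lam <= r -> bounded_covariates M D ->
  1 <= 1 + expR (ipw_exponent lam D i) <= 1 + expR (M * r).
Proof.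
move=> lr DM; rewrite lerDl expR_ge0 lerD2l ler_expR/=.
by rewrite (le_trans (ler_norm _))// norm_ipw_exponent dot_bound.
Qed.

Lemma ipw_stable n p (lam : 'rV[R]_p) (D D' : dataset R n p) M r :
  norm2 lam <= r -> bounded_covariates M D -> bounded_covariates M D' ->
  differ_at_one_point D D' ->
  norm2 (ipw lam D - ipw lam D') <=
  (1 + (1 + expR (M * r))) * (1 + expR (M * r)).
Proof.
move=> lr DM D'M [k [_ DD']]; apply: (@normalized_one_point _ _ _ k).
- by move=> i /DD'; rewrite /treatment /covariate => ->.
- by move=> i; exact: ipw_factor_bounds.
- by move=> i; exact: ipw_factor_bounds.
Qed.

(** Multiplicatively, [1 + e^s <= e^|s - t| * (1 + e^t)], term by term. *)
Lemma softplus_lip (s t : R) : ln (1 + expR s) - ln (1 + expR t) <= `|s - t|.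
Proof.
have p (x : R) : 0 < 1 + expR x by have := expR_gt0 x; lra.
rewrite -ln_div ?posrE// -[leRHS]expRK ler_ln ?posrE ?expR_gt0 ?divr_gt0//.
rewrite ler_pdivrMr// mulrDr mulr1 lerD//.
  by rewrite -expR0 ler_expR.
rewrite -expRD ler_expR; have := ler_norm (s - t); lra.
Qed.

(** For [B >= 0], a crude lower bound on [-B, B] of the second derivative [e^x / (1 + e^x)^2] of
    [ln (1 + e^x)]. *)
Definition softplus_curv (B : R) : R := expR (- B) ^+ 2 / (1 + expR B) ^+ 2.

(** With [a = e^(u/2)] and [b = e^(v/2)], the gap is the identity [(1 + a^2) (1 + b^2) - (1 + a b)^2
    = (a - b)^2]. The half exponents give 1/4, and the halved logarithms make it 1/8. *)
Lemma softplus_midpoint (B u v : R) : `|u| <= B -> `|v| <= B ->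
  ln (1 + expR ((u + v) / 2)) <= (ln (1 + expR u) + ln (1 + expR v)) / 2
    - softplus_curv B / 8 * (u - v) ^+ 2.
Proof.
rewrite /softplus_curv.
move=> uB vB; have /andP[uB1 uB2] : - B <= u <= B by rewrite -ler_norml.
have /andP[vB1 vB2] : - B <= v <= B by rewrite -ler_norml.
have B0 : 0 <= B by exact: le_trans uB.
have p (x : R) : 0 < 1 + expR x by have := expR_gt0 x; lra.
pose a := expR (u / 2); pose b := expR (v / 2).
have Ea : expR u = a ^+ 2 by rewrite -expRM_natl; congr expR; field.
have Eb : expR v = b ^+ 2 by rewrite -expRM_natl; congr expR; field.
have Eab : expR ((u + v) / 2) = a * b by rewrite -expRD; congr expR; field.
pose X := (1 + expR u) * (1 + expR v).
pose Y := (1 + expR ((u + v) / 2)) ^+ 2.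
have X0 : 0 < X by rewrite mulr_gt0.
have XB : X <= (1 + expR B) ^+ 2.
  by rewrite expr2 ler_pM ?(ltW (p _))// lerD2l ler_expR.
have := ln_gap X0 (exprn_gt0 2 (p ((u + v) / 2))).
rewrite -/Y lnM ?posrE// lnXn// -[_ *+ 2]mulr_natr.
suff : expR (- B) ^+ 2 / (1 + expR B) ^+ 2 / 4 * (u - v) ^+ 2 <= 1 - Y / X by lra.
have -> : 1 - Y / X = (a - b) ^+ 2 / X.
  rewrite /X Ea Eb /Y Eab; field; rewrite -Ea -Eb !gt_eqF//.
have ab : expR (- B) ^+ 2 * (u - v) ^+ 2 / 4 <= (a - b) ^+ 2.
  have -> : expR (- B) ^+ 2 * (u - v) ^+ 2 / 4 = (expR (- B) * `|u / 2 - v / 2|) ^+ 2.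
    by rewrite exprMn real_normK ?num_real//; field.
  rewrite -(real_normK (num_real (a - b))) ler_sqr ?nnegrE ?mulr_ge0 ?expR_ge0//.
  apply: expR_lip_ge; lra.
have -> : expR (- B) ^+ 2 / (1 + expR B) ^+ 2 / 4 * (u - v) ^+ 2 =
    expR (- B) ^+ 2 * (u - v) ^+ 2 / 4 * ((1 + expR B) ^+ 2)^-1.
  by ring.
apply: ler_pM => //; rewrite ?invr_ge0 ?sqr_ge0//.
  by rewrite divr_ge0// mulr_ge0// sqr_ge0.
by rewrite lef_pV2 ?posrE// exprn_gt0.
Qed.

Lemma logistic_midpoint n p (reg : R) (D : dataset R n p) (u v : 'rV[R]_p) M r :
  bounded_covariates M D -> norm2 u <= r -> norm2 v <= r ->
  logistic_objective reg D (2^-1 *: (u + v)) <=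
  (logistic_objective reg D u + logistic_objective reg D v) / 2 -
  (softplus_curv (M * r) / n%:R * (\sum_i dot (covariate D i) (v - u) ^+ 2)
    + reg * norm2 (v - u) ^+ 2) / 8.
Proof.
move=> DM ur vr; rewrite /logistic_objective norm2_midpoint.
set F := fun w => \sum_i (ln (1 + expR (dot (covariate D i) w))
                     - (treatment D i)%:R * dot (covariate D i) w).
rewrite -!/(F _); set k := softplus_curv _.
suff h : F (2^-1 *: (u + v)) <= (F u + F v) / 2 -
    k / 8 * (\sum_i dot (covariate D i) (v - u) ^+ 2).
  have := ler_wpM2l (_ : 0 <= n%:R^-1) h; rewrite invr_ge0 ler0n => /(_ isT); lra.
rewrite /F -big_split/= mulr_suml mulr_sumr -sumrB; apply: ler_sum => i _.
rewrite dotZr dotDr dotBr.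
have := softplus_midpoint (dot_bound (DM i) ur) (dot_bound (DM i) vr).
rewrite -/k [2^-1 * _]mulrC; lra.
Qed.

(** In this second difference the penalty and all shared summands cancel. The constant 4 counts two
    datasets, each with Lipschitz constant 1 for the softplus and 1 for the linear term. *)
Lemma logistic_objective_diff n p (reg : R) (D D' : dataset R n p) (u v : 'rV[R]_p) M :
  bounded_covariates M D -> bounded_covariates M D' -> differ_at_one_point D D' ->
  (logistic_objective reg D v - logistic_objective reg D' v) -
  (logistic_objective reg D u - logistic_objective reg D' u) <=
  n%:R^-1 * (4 * (M * norm2 (v - u))).
Proof.
move=> DM D'M [k [_ DD']].
pose l (E : dataset R n p) w i := ln (1 + expR (dot (covariate E i) w))
                     - (treatment E i)%:R * dot (covariate E i) w.
have lE w : logistic_objective reg D w - logistic_objective reg D' w =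
    n%:R^-1 * (l D w k - l D' w k).
  rewrite /logistic_objective opprD addrACA subrr addr0 -mulrBr -sumrB.
  congr (_ * _); apply: (sum_one_point (k := k)) => i /DD'.
  by rewrite /covariate /treatment => ->; rewrite subrr.
rewrite !lE -mulrBr ler_wpM2l ?invr_ge0 ?ler0n//.
have lip (E : dataset R n p) w w' : bounded_covariates M E ->
    l E w k - l E w' k <= 2 * (M * norm2 (w - w')).
  move=> EM; have := dot_bound (EM k) (lexx (norm2 (w - w'))).
  rewrite dotBr => h.
  have := softplus_lip (dot (covariate E k) w) (dot (covariate E k) w').
  have := ler_norm (- (dot (covariate E k) w - dot (covariate E k) w')).
  have := normr_ge0 (dot (covariate E k) w - dot (covariate E k) w').
  by rewrite normrN /l; case: treatment; rewrite /= ?mul1r ?mul0r; lra.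
have := lip D v u DM; have := lip D' u v D'M.
clearbody l; rewrite -[norm2 (u - v)]norm2N opprB; lra.
Qed.

(** Bounds what [u] can gain over the zero parameter, which later controls the size of the estimate
    itself. *)
Lemma logistic_objective0 n p (reg : R) (D : dataset R n p) (u : 'rV[R]_p) M :
  (0 < n)%N -> 0 <= reg -> bounded_covariates M D ->
  logistic_objective reg D 0 - logistic_objective reg D u <= 2 * M * norm2 u.
Proof.
move=> n0 reg0 DM; rewrite /logistic_objective norm20 expr0n mulr0 addr0.
have h : \sum_i (ln (1 + expR (dot (covariate D i) 0)) -
      (treatment D i)%:R * dot (covariate D i) 0) -
    \sum_i (ln (1 + expR (dot (covariate D i) u)) -
      (treatment D i)%:R * dot (covariate D i) u) <= n%:R * (2 * M * norm2 u).
  rewrite -sumrB -sumr_ord; apply: ler_sum => i _.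
  have := dot_bound (DM i) (lexx (norm2 u)).
  have := softplus_lip 0 (dot (covariate D i) u).
  rewrite dot0r mulr0 sub0r normrN.
  have := ler_norm (dot (covariate D i) u).
  have := normr_ge0 (dot (covariate D i) u).
  by case: treatment; rewrite /= ?mul1r ?mul0r; lra.
have np : 0 < n%:R :> R by rewrite ltr0n.
have := h; rewrite -ler_pdivrMl// mulrBr.
have := mulr_ge0 reg0 (sqr_ge0 (norm2 u)); lra.
Qed.

End InverseProbability.

(** * Stability of the logistic estimate and of its weights *)

Section LogisticRegression.
Context {R : realType}.

Lemma softplus_curv_bounds (B : R) : 0 <= B -> 0 < softplus_curv B <= 1.
Proof.
move=> B0; have e1 : 1 <= expR B by rewrite -expR0 ler_expR.
have e2 : expR (- B) <= 1 by rewrite -expR0 ler_expR oppr_le0.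
have ep : 0 < (1 + expR B) ^+ 2 by rewrite exprn_gt0//; lra.
rewrite /softplus_curv divr_gt0 ?exprn_gt0 ?expR_gt0//= ler_pdivrMr// mul1r.
rewrite ler_sqr ?nnegrE ?expR_ge0//; lra.
Qed.

Lemma ipw_exponentB n p (u v : 'rV[R]_p) (D : dataset R n p) i :
  ipw_exponent u D i - ipw_exponent v D i = ipw_exponent (u - v) D i.
Proof. by rewrite /ipw_exponent dotBr; ring. Qed.

Lemma logistic_estimate_close n p (reg : R) (D D' : dataset R n p) (u v : 'rV[R]_p) M r :
  0 <= reg -> bounded_covariates M D -> bounded_covariates M D' ->
  0 < lambda_min (second_moment D) ->
  logistic_estimate r reg D u -> logistic_estimate r reg D' v ->
  differ_at_one_point D D' ->
  \sum_i dot (covariate D i) (v - u) ^+ 2 + (norm2 u + norm2 v) ^+ 2 <=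
  decay_const (softplus_curv (M * r)) (16 * M) (M ^+ 2) r *
     Num.min 1 (1 / (lambda_min (second_moment D) + reg)) ^+ 2.
Proof.
move=> reg0 DM D'M l0 uD vD' DD'; set k := softplus_curv _; have n0 := one_point_size DD'.
have np : 0 < n%:R :> R by rewrite ltr0n.
have [ur uF] := uD; have [vr vF] := vD'.
rewrite /ball2/= in ur vr.
have r0 : 0 <= r by exact: le_trans (norm2_ge0 u) ur.
have M0 : 0 <= M by rewrite (le_trans (norm2_ge0 _) (DM (Ordinal n0))).
have /andP[k0 k1] : 0 < k <= 1 by apply: softplus_curv_bounds; rewrite mulr_ge0.
(* The midpoint gap has denominator 8 and enters as [2 * q], hence the factor 4. The inequality
   serves at [w = v] for the distance and at [w = 0] for the size of [u]. *)
have step w : norm2 w <= r ->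
    k / n%:R * (\sum_i dot (covariate D i) (w - u) ^+ 2) + reg * norm2 (w - u) ^+ 2
    <= 4 * (logistic_objective reg D w - logistic_objective reg D u).
  move=> wr; have := argmin_midpoint uD (ball2_midpoint ur wr)
    (logistic_midpoint reg DM ur wr).
  by rewrite -/k; lra.
have gap w := @lambda_min_gram R n p (covariate D) w n0.
apply: (@regularized_decay _ n%:R _ _ _ _ _ _ _ (norm2 (v - u))) => //.
- by rewrite ler1n.
- by rewrite k0.
- by rewrite mulr_ge0.
- exact: ltW.
- by rewrite ltr_pwDl.
- by apply: sumr_ge0 => i _; rewrite sqr_ge0.
- exact: norm2_ge0.
- by rewrite norm2_ge0.
- by rewrite norm2_ge0.
- by rewrite [leRHS]addrC norm2B.
- by rewrite -{1}(subrKC u v) norm2D.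
(* Minimality of [v] for [D'] reduces the gap to the second difference, and 4 times 4 gives
   [16 * M]; comparison with 0 costs [8 * M], which fits in the same constant. *)
- apply: le_trans (step v vr) _.
  have := logistic_objective_diff reg u v DM D'M DD'.
  have := vF u ur; lra.
- exact: sum_sqr_dot_le.
- have := step 0; rewrite norm20 sub0r norm2N => /(_ r0) h.
  have := logistic_objective0 u n0 reg0 DM.
  have := gap (- u); rewrite norm2N -mulrA => h'.
  have : k / n%:R * (n%:R * (lambda_min (second_moment D) * norm2 u ^+ 2)) <=
    k / n%:R * \sum_i dot (covariate D i) (- u) ^+ 2.
    by rewrite ler_wpM2l// divr_ge0 ?(ltW k0)// ltW.
  rewrite [leLHS]mulrA divfK ?gt_eqF//.
  have := mulr_ge0 M0 (norm2_ge0 u); lra.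
Qed.

Lemma ipw_estimated_stable n p (reg : R) (D D' : dataset R n p) (u v : 'rV[R]_p) M r :
  0 <= reg -> bounded_covariates M D -> bounded_covariates M D' ->
  0 < lambda_min (second_moment D) ->
  logistic_estimate r reg D u -> logistic_estimate r reg D' v ->
  differ_at_one_point D D' ->
  norm2 (ipw u D - ipw v D') <=
  (1 + (1 + expR (M * r))) * (expR (M * r) * Num.sqrt ((1 + M ^+ 2) *
    decay_const (softplus_curv (M * r)) (16 * M) (M ^+ 2) r)) *
     Num.min 1 (1 / (lambda_min (second_moment D) + reg)).
Proof.
move=> reg0 DM D'M l0 uD vD' DD'.
have := logistic_estimate_close reg0 DM D'M l0 uD vD' DD'.
have n0 := one_point_size DD'; move: DD' => [k [_ DD']].
set c := decay_const _ _ _ _; set mn := Num.min _ _ => h /=.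
have [ur _] := uD; have [vr _] := vD'; rewrite /ball2/= in ur vr.
have M0 : 0 <= M by rewrite (le_trans (norm2_ge0 _) (DM (Ordinal n0))).
have mn0 : 0 <= mn by rewrite le_min ler01 divr_ge0// addr_ge0// ltW.
have r0 : 0 <= r by exact: le_trans (norm2_ge0 u) ur.
have /andP[k0 _] := softplus_curv_bounds (mulr_ge0 M0 r0).
have c0 : 0 <= c by rewrite decay_const_ge0 ?mulr_ge0 ?(ltW k0).
set a := norm2 u + norm2 v in h.
have a0 : 0 <= a by rewrite addr_ge0 ?norm2_ge0.
set V := \sum_i _ in h.
have V0 : 0 <= V by apply: sumr_ge0 => i _; rewrite sqr_ge0.
set B := M * r.
rewrite -mulrA (_ : 1 + (1 + expR B) = 1^-1 + (1 + expR B) / 1 ^+ 2); last first.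
  by rewrite invr1 expr1n divr1.
apply: normalized_lip => //.
- by rewrite !mulr_ge0 ?expR_ge0 ?sqrtr_ge0.
- by move=> i; have /andP[] := ipw_factor_bounds i ur DM.
- by move=> i; have /andP[] := ipw_factor_bounds i vr D'M.
- by move=> i; have /andP[] := ipw_factor_bounds i vr D'M.
(* At [k] the two exponents belong to different data and are bounded separately; elsewhere they
   differ by the predictor of [v - u]. *)
have bound i : ((1 + expR (ipw_exponent u D i)) - (1 + expR (ipw_exponent v D' i))) ^+ 2
    <= expR B ^+ 2 * (dot (covariate D i) (v - u) ^+ 2 + (i == k)%:R * (M * a) ^+ 2).
  have expB (E : dataset R n p) w : bounded_covariates M E -> norm2 w <= r ->
      ipw_exponent w E i <= B.
    move=> EM wr; apply: le_trans (ler_norm _) _.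
    by rewrite norm_ipw_exponent dot_bound.
  have := expR_lip_le (expB _ _ DM ur) (expB _ _ D'M vr).
  rewrite opprD addrACA subrr add0r.
  rewrite -ler_sqr ?nnegrE ?mulr_ge0 ?expR_ge0// exprMn real_normK ?num_real//.
  move/le_trans; apply; rewrite ler_pM2l ?exprn_gt0 ?expR_gt0//.
  have [->|ik] := eqVneq i k.
    rewrite mul1r ler_wpDl ?sqr_ge0// ler_sqr ?nnegrE ?mulr_ge0//.
    apply: le_trans (ler_normB _ _) _; rewrite !norm_ipw_exponent mulrDr.
    by rewrite lerD// dot_bound.
  rewrite mul0r addr0 (_ : ipw_exponent v D' i = ipw_exponent v D i); last first.
    by rewrite /ipw_exponent /treatment /covariate DD'.
  rewrite ipw_exponentB norm_ipw_exponent -[dot _ (v - u) ^+ 2]real_normK ?num_real//.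
  by rewrite -opprB dotNr normrN.
apply: le_trans (ler_sum _ (fun i _ => bound i)) _.
rewrite -mulr_sumr big_split/= -/V (sum_one_point (k := k)); last first.
  by move=> i /negbTE ->; rewrite mul0r.
have key : V + (M * a) ^+ 2 <= (1 + M ^+ 2) * (c * mn ^+ 2).
  have := ler_wpM2l (_ : 0 <= 1 + M ^+ 2) h; rewrite addr_ge0 ?sqr_ge0// => /(_ isT).
  have := mulr_ge0 (sqr_ge0 M) V0; have := sqr_ge0 a; lra.
rewrite eqxx mul1r [leRHS](_ : _ = expR B ^+ 2 * ((1 + M ^+ 2) * (c * mn ^+ 2))).
  by rewrite ler_pM2l// exprn_gt0// expR_gt0.
have M1 : 0 <= 1 + M ^+ 2 by rewrite addr_ge0 ?sqr_ge0.
by rewrite !exprMn sqr_sqrtr ?(mulr_ge0 M1 c0)//; ring.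
Qed.

End LogisticRegression.

(** * MMD weights: kernels and perturbed quadratic programs *)

Section MaximumMeanDiscrepancy.
Context {R : realType}.

Lemma kernel_sym (X : Type) (K : X -> X -> R) : reproducing_kernel K ->
  forall x y, K x y = K y x.
Proof.
move=> [H [ip [hH HK rep]]] x y.
by rewrite -(rep y (K x))// (hfs_ip_sym hH)// rep.
Qed.

(** By the reproducing property, the double sum is the squared Hilbert norm of the combination of
    the functions [K (x j)] with coefficients [c j]. *)
Lemma kernel_psd (X : Type) (K : X -> X -> R) (I : finType) (x : I -> X) (c : I -> R) :
  reproducing_kernel K -> 0 <= \sum_i \sum_j c i * c j * K (x i) (x j).
Proof.
move=> [H [ip [hH HK rep]]].
(* The combination is built along a list, since the axioms of [hilbert_function_space] give
   linearity for two functions at a time. *)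
pose f s y := \sum_(j <- s) c j * K (x j) y.
have [Hf ipf] : (forall s, H (f s)) /\
    forall s g, H g -> ip (f s) g = \sum_(j <- s) c j * ip (K (x j)) g.
  have f0 : f [::] = fun=> 0 by apply/funext => y; rewrite /f big_nil.
  have fS j s : f (j :: s) = fun y => c j * K (x j) y + f s y.
    by apply/funext => y; rewrite /f big_cons.
  have Hf s : H (f s).
    elim: s => [|j s IH]; first by rewrite f0; exact: hfs_zero hH.
    by rewrite fS; apply: (hfs_lin hH).
  split=> // s g Hg; elim: s => [|j s IH]; last first.
    by rewrite fS (hfs_ip_lin hH)// IH big_cons.
  rewrite f0 big_nil; have H0 := hfs_zero hH.
  have := hfs_ip_lin hH 1 H0 H0 Hg.
  rewrite (_ : (fun y => 1 * 0 + 0) = fun=> 0); last by apply/funext => y; rewrite mulr0 addr0.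
  lra.
have := hfs_ip_ge0 hH (Hf (index_enum I)); rewrite ipf//.
congr (_ <= _); apply: eq_bigr => i _.
rewrite (hfs_ip_sym hH)// rep// /f mulr_sumr; apply: eq_bigr => j _.
by rewrite mulrA (kernel_sym _ (x j))//; exists H, ip.
Qed.

Lemma mmd_matrix_sym n p (K : 'rV[R]_p -> 'rV[R]_p -> R) alpha reg
    (D : dataset R n p) : reproducing_kernel K ->
  (mmd_matrix K alpha reg D)^T = mmd_matrix K alpha reg D.
Proof.
move=> hK; apply/matrixP => i j; rewrite !mxE (kernel_sym hK).
by rewrite [treatment D j == _]eq_sym [j == i]eq_sym.
Qed.

(* The sign pattern of the two treatment groups is positive semidefinite:
   [s i j = alpha * [a_i = a_j] + (1 - alpha) * eps_i * eps_j], eps_i = +-1. *)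
Lemma mmd_matrix_coercive n p (K : 'rV[R]_p -> 'rV[R]_p -> R) alpha reg
    (D : dataset R n p) (u : 'rV[R]_n) : reproducing_kernel K -> 0 <= alpha <= 1 ->
  reg / n%:R ^+ 2 * norm2 u ^+ 2 <= dot (u *m mmd_matrix K alpha reg D) u.
Proof.
move=> hK /andP[al0 al1]; rewrite dot_mulmxE sqr_norm2 dotE.
pose Q c := \sum_i \sum_j c i * c j * K (covariate D i) (covariate D j).
have Q0 c : 0 <= Q c by exact: kernel_psd.
pose t i : R := (treatment D i)%:R.
(* Equality of treatments splits as [t i * t j + (1 - t i) * (1 - t j)], so each piece is a kernel
   form with modified coefficients. *)
have -> : \sum_i \sum_j u 0 i * mmd_matrix K alpha reg D i j * u 0 j =
    (n%:R ^+ 2)^-1 * (alpha * Q (fun i => t i * u 0 i)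
      + alpha * Q (fun i => (1 - t i) * u 0 i)
      + (1 - alpha) * Q (fun i => (2 * t i - 1) * u 0 i)
      + reg * \sum_i u 0 i * u 0 i).
  rewrite /Q !mulr_sumr -!big_split/= mulr_sumr; apply: eq_bigr => i _.
  have -> : reg * (u 0 i * u 0 i) = \sum_j reg * (i == j)%:R * u 0 i * u 0 j.
    rewrite (bigD1 i)//= big1 ?eqxx ?addr0 ?mulr1 ?mulrA//.
    by move=> j; rewrite eq_sym => /negbTE ->; rewrite mulr0 !mul0r.
  rewrite !mulr_sumr -!big_split/= mulr_sumr; apply: eq_bigr => j _.
  rewrite mxE /t; case: (treatment D i); case: (treatment D j); rewrite /=; ring.
have := addr_ge0 (addr_ge0 (mulr_ge0 al0 (Q0 (fun i => t i * u 0 i)))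
  (mulr_ge0 al0 (Q0 (fun i => (1 - t i) * u 0 i))))
  (mulr_ge0 (_ : 0 <= 1 - alpha) (Q0 (fun i => (2 * t i - 1) * u 0 i))).
rewrite subr_ge0 => /(_ al1) h.
rewrite -mulrA mulrCA ler_wpM2l ?invr_ge0 ?sqr_ge0//; lra.
Qed.

Lemma quadratic_midpoint n (A : 'M[R]_n) (b u v : 'rV[R]_n) : A^T = A ->
  let F w := dot (w *m A) w - 2 * dot w b in
  F (2^-1 *: (u + v)) = (F u + F v) / 2 - dot ((v - u) *m A) (v - u) / 4.
Proof.
move=> As F; rewrite /F mulmxBl -scalemxAl mulmxDl.
rewrite !(dotZl, dotZr, dotBl, dotBr, dotDl, dotDr) (dot_mulmxC v u As).
by field.
Qed.

Lemma quadratic_diff n (A : 'M[R]_n) (b u v : 'rV[R]_n) : A^T = A ->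
  (dot (v *m A) v - 2 * dot v b) - (dot (u *m A) u - 2 * dot u b) =
  dot ((u + v) *m A) (v - u) - 2 * dot b (v - u).
Proof.
move=> As; rewrite mulmxDl !(dotBr, dotDl) (dot_mulmxC v u As) !(dotC b).
by ring.
Qed.

(** The squares add up to at most [b^2 / n + b^2]. This is the profile left by a change of one row
    and one column: a single large entry, the others smaller by a factor [n]. *)
Lemma norm2_one_point_le n (z : 'rV[R]_n) k b : 0 <= b ->
  (forall i, i != k -> `|z 0 i| <= b / n%:R) -> `|z 0 k| <= b -> norm2 z <= 2 * b.
Proof.
move=> b0 zi zk; apply: norm2_sqr_le; first by rewrite mulr_ge0.
have n1 : 1 <= n%:R :> R by rewrite ler1n; exact: leq_ltn_trans (ltn_ord k).
rewrite dotE.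
apply: (@le_trans _ _ (\sum_i ((b / n%:R) ^+ 2 + (i == k)%:R * b ^+ 2))).
  apply: ler_sum => i _; rewrite -expr2 -(real_normK (num_real (z 0 i))).
  have [->|ik] := eqVneq i k.
    by rewrite mul1r ler_wpDl ?sqr_ge0// ler_sqr.
  by rewrite mul0r addr0 ler_sqr ?nnegrE ?zi// divr_ge0.
rewrite big_split/= sumr_ord (sum_one_point (k := k)); last first.
  by move=> i /negbTE ->; rewrite mul0r.
rewrite eqxx mul1r [n%:R * _](_ : _ = n%:R^-1 * b ^+ 2); last first.
  by field; rewrite gt_eqF// (lt_le_trans ltr01).
have : n%:R^-1 * b ^+ 2 <= 1 * b ^+ 2.
  by rewrite ler_wpM2r ?sqr_ge0// invf_le1// (lt_le_trans ltr01).
have := sqr_ge0 b; lra.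
Qed.

(** The diagonal regularization cancels and the sign factors have absolute value at most 1, so only
    row and column [k] survive. *)
Lemma mmd_matrix_diff n p (K : 'rV[R]_p -> 'rV[R]_p -> R) alpha reg
    (D D' : dataset R n p) C k i j : 0 <= alpha <= 1 ->
  (forall i j, `|K (covariate D i) (covariate D j)| <= C) ->
  (forall i j, `|K (covariate D' i) (covariate D' j)| <= C) ->
  (forall i, i != k -> D i = D' i) ->
  `|(mmd_matrix K alpha reg D - mmd_matrix K alpha reg D') i j| <=
  ((i == k) || (j == k))%:R * (2 * C / n%:R ^+ 2).
Proof.
move=> /andP[al0 al1] KC K'C DD'; rewrite !mxE -mulrBr opprD addrACA subrr addr0.
have [_|/norP[ik jk]] := boolP (_ || _); last first.
  by rewrite /treatment /covariate !DD'// subrr mulr0 normr0 mul0r.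
pose s (b : bool) : R := if b then 1 else alpha - 1.
have s1 b : `|s b| <= 1 by case: b; rewrite /s ?normr1// ler_norml; lra.
have sK b x : `|x| <= C -> `|s b * x| <= C.
  by move=> xC; rewrite normrM -[C]mul1r ler_pM.
rewrite mul1r normrM ger0_norm ?invr_ge0 ?sqr_ge0// [leRHS]mulrC.
rewrite ler_wpM2l ?invr_ge0 ?sqr_ge0// (le_trans (ler_normB _ _))//.
have := sK (treatment D i == treatment D j) _ (KC i j).
have := sK (treatment D' i == treatment D' j) _ (K'C i j).
rewrite /s; lra.
Qed.

(** The curvature is [reg / n^2], while one data point acts with slope of order 1/n; their quotient
    is the rate [n / reg]. *)
Lemma mmd_stable n p (K : 'rV[R]_p -> 'rV[R]_p -> R) (alpha reg C r : R)
    (D D' : dataset R n p) (u v : 'rV[R]_n) :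
  reproducing_kernel K -> 0 <= alpha <= 1 -> 0 < reg ->
  (forall i j, `|K (covariate D i) (covariate D j)| <= C) ->
  (forall i j, `|K (covariate D' i) (covariate D' j)| <= C) ->
  mmd_weights K alpha reg r D u -> mmd_weights K alpha reg r D' v ->
  differ_at_one_point D D' ->
  norm2 (u - v) <= 16 * (r * C + C) * (n%:R / reg).
Proof.
move=> hK al reg0 KC K'C uD vD' DD'; have n0 := one_point_size DD'.
move: DD' => [k [_ DD']]; have [ur uF] := uD; have [vr vF] := vD'.
rewrite /= in ur vr.
have np : 0 < n%:R :> R by rewrite ltr0n.
have C0 : 0 <= C by exact: le_trans (KC k k).
have r0 : 0 <= r by exact: le_trans ur.
have entry (w : 'rV[R]_n) i : `|w 0 i| <= `|w|.
  by rewrite [leRHS]/Num.Def.normr/= mx_normrE; apply/bigmax_geP; right => /=; exists (0, i).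
set A := mmd_matrix K alpha reg D in uD uF *.
set A' := mmd_matrix K alpha reg D' in vD' vF *.
set b := mmd_vector K alpha D in uD uF *.
set b' := mmd_vector K alpha D' in vD' vF *.
have As : A^T = A by exact: mmd_matrix_sym.
have A's : A'^T = A' by exact: mmd_matrix_sym.
have Ds : (A - A')^T = A - A' by rewrite linearB/= As A's.
have mid : `|2^-1 *: (u + v)| <= r.
  rewrite normrZ ger0_norm ?invr_ge0//.
  have := ler_normD u v; lra.
have q := @argmin_midpoint R n _ _ u v (dot ((v - u) *m A) (v - u) / 4) uD mid.
rewrite (quadratic_midpoint b u v As) in q; move: (q (lexx _)) => {}q.
have co := @mmd_matrix_coercive n p K alpha reg D (v - u) hK al.
have up i : `|(u + v) 0 i| <= 2 * r.
  rewrite mxE (le_trans (ler_normD _ _))//.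
  have := le_trans (entry u i) ur; have := le_trans (entry v i) vr; lra.
(* Entries of [u + v] are at most [2 * r] by the sup-norm constraint. Column [k] has [n] nonzero
   terms, any other column only one. *)
have prod_le j : `|((u + v) *m (A - A')) 0 j| <=
    \sum_i ((i == k) || (j == k))%:R * (4 * r * C / n%:R ^+ 2).
  rewrite mxE (le_trans (ler_norm_sum _ _ _))//; apply: ler_sum => i _.
  rewrite normrM [leRHS](_ : _ = (2 * r) * (((i == k) || (j == k))%:R * (2 * C / n%:R ^+ 2))).
    by rewrite ler_pM// mmd_matrix_diff.
  by ring.
have mat : norm2 ((u + v) *m (A - A')) <= 2 * (4 * r * C / n%:R).
  apply: (norm2_one_point_le (k := k)) => [|j jk|]; first by rewrite !divr_ge0 ?mulr_ge0.
    apply: le_trans (prod_le j) _; rewrite (sum_one_point (k := k)).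
      by rewrite eqxx mul1r expr2 invfM mulrA.
    by move=> i /negbTE ->; rewrite (negbTE jk) mul0r.
  apply: le_trans (prod_le k) _; under eq_bigr do rewrite eqxx orbT mul1r.
  rewrite sumr_ord [leLHS](_ : _ = 4 * r * C / n%:R)//.
  by field; rewrite gt_eqF.
have dK i j : `|K (covariate D i) (covariate D j) - K (covariate D' i) (covariate D' j)| <=
    ((i == k) || (j == k))%:R * (2 * C).
  have [_|/norP[ik jk]] := boolP (_ || _); last first.
    by rewrite /covariate !DD'// subrr normr0 mul0r.
  rewrite mul1r (le_trans (ler_normB _ _))//.
  have := KC i j; have := K'C i j; lra.
have vec_le i : `|(b - b') 0 i| <=
    \sum_j ((i == k) || (j == k))%:R * (2 * C / n%:R ^+ 2).
  rewrite !mxE -mulrBr -sumrB normrM ger0_norm; last first.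
    by rewrite divr_ge0 ?sqr_ge0//; case/andP: al.
  apply: (@le_trans _ _ (1 / n%:R ^+ 2 * \sum_j ((i == k) || (j == k))%:R * (2 * C))).
    apply: ler_pM => //; first by rewrite divr_ge0 ?sqr_ge0//; case/andP: al.
    - by rewrite ler_wpM2r ?invr_ge0 ?sqr_ge0//; case/andP: al.
    - rewrite (le_trans (ler_norm_sum _ _ _))//; apply: ler_sum => j _.
      exact: dK.
  by rewrite mulr_sumr; apply: ler_sum => j _; rewrite mul1r mulrCA [_^-1 * _]mulrC.
have vec : norm2 (b - b') <= 2 * (2 * C / n%:R).
  apply: (norm2_one_point_le (k := k)) => [|j jk|]; first by rewrite !divr_ge0 ?mulr_ge0.
    apply: le_trans (vec_le j) _; rewrite (sum_one_point (k := k)).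
      by rewrite eqxx orbT mul1r expr2 invfM mulrA.
    by move=> i /negbTE ->; rewrite (negbTE jk) mul0r.
  apply: le_trans (vec_le k) _; under eq_bigr do rewrite eqxx mul1r.
  rewrite sumr_ord [leLHS](_ : _ = 2 * C / n%:R)//.
  by field; rewrite gt_eqF.
have d := quadratic_diff b u v As; have d' := quadratic_diff b' u v A's.
have v'u := vF u ur.
set H := norm2 (v - u) in co.
have H0 : 0 <= H by exact: norm2_ge0.
have m1 := le_trans (ler_norm _) (dot_bound mat (lexx H)).
have m2 : - dot (b - b') (v - u) <= 2 * (2 * C / n%:R) * H.
  have := dot_bound vec (lexx H); rewrite ler_norml => /andP[+ _]; lra.
rewrite mulmxBr !dotBl in m1 m2.
(* Twice the sum of [8 * r * C / n] from the matrix and [2 * (4 * C / n)] from the vector. *)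
have main : reg / n%:R ^+ 2 * H ^+ 2 <= 16 * (r * C + C) / n%:R * H by lra.
rewrite -norm2N opprB -/H.
have [->|Hn0] := eqVneq H 0.
  have rC : 0 <= r * C + C by rewrite addr_ge0 ?mulr_ge0.
  by apply: mulr_ge0; [rewrite mulr_ge0 | rewrite divr_ge0// ltW].
have Hp : 0 < H by rewrite lt_neqAle eq_sym Hn0.
have rH : 0 < reg / n%:R ^+ 2 * H by rewrite mulr_gt0 ?divr_gt0 ?exprn_gt0.
rewrite -(ler_pM2l rH) [leLHS](_ : _ = reg / n%:R ^+ 2 * H ^+ 2); last by ring.
apply: le_trans main _.
rewrite le_eqVlt; apply/orP; left; apply/eqP; field.
by rewrite !gt_eqF.
Qed.

End MaximumMeanDiscrepancy.

(** * Curvature and perturbation of the weighted log-sum-exp *)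

Section LogSumExp.
Context {R : realType}.

(** The mean of [q] is 1/n, hence lies between its minimum and its maximum; so [n * q i] stays in
    [1/rq, rq], which keeps all later constants free of [n]. *)
Lemma max_min_ratio_bounds n (q : 'I_n -> R) i :
  positive_probability q -> let rq := max_min_ratio q in
  [/\ 1 <= rq, n%:R * q i <= rq & 1 <= rq * (n%:R * q i)].
Proof.
move=> [q0 q1]; rewrite /max_min_ratio /=.
set qM := \big[Num.max/0]_i q i; set qm := \big[Num.min/qM]_i q i.
have qM_ge j : q j <= qM by exact: le_bigmax.
have qm_le j : qm <= q j by exact: bigmin_le_cond.
have qM0 : 0 < qM by exact: lt_le_trans (q0 i) (qM_ge i).
have qm0 : 0 < qm.
  by rewrite /qm; elim/big_ind: _ => // x y x0 y0; rewrite lt_min x0.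
have nM : 1 <= n%:R * qM by rewrite -[leLHS]q1 -sumr_ord ler_sum.
have nm : n%:R * qm <= 1 by rewrite -[leRHS]q1 -sumr_ord ler_sum.
split.
- by rewrite ler_pdivlMr// mul1r (le_trans (qm_le i)).
- rewrite ler_pdivlMr// mulrAC -[leRHS]mul1r.
  by rewrite ler_pM ?mulr_ge0 ?(ltW qm0) ?(ltW (q0 _)).
- rewrite -mulrA (le_trans nM)// mulrC ler_wpM2l ?(ltW qM0)//.
  by rewrite ler_pdivlMl// mulrC ler_wpM2l.
Qed.

Section Weighted.
Variables (n : nat) (q : 'I_n -> R).
Hypothesis q_prob : positive_probability q.

Let q0 i : 0 < q i. Proof. by case: q_prob. Qed.

Lemma wsum_le (B : R) (a : 'I_n -> R) : (forall i, a i <= B) -> \sum_i q i * a i <= B.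
Proof.
move=> aB; have [_ q1] := q_prob; rewrite -[leRHS]mul1r -q1 mulr_suml.
by apply: ler_sum => i _; rewrite ler_wpM2l// ltW.
Qed.

Lemma wsum_ge (B : R) (a : 'I_n -> R) : (forall i, B <= a i) -> B <= \sum_i q i * a i.
Proof.
move=> aB; have [_ q1] := q_prob; rewrite -[leLHS]mul1r -q1 mulr_suml.
by apply: ler_sum => i _; rewrite ler_wpM2l// ltW.
Qed.

Lemma wsum_exp_gt0 (a : 'I_n -> R) : (0 < n)%N -> 0 < \sum_i q i * expR (a i).
Proof.
move=> n0; rewrite (bigD1 (Ordinal n0))//= ltr_pwDl ?mulr_gt0 ?expR_gt0//.
by apply: sumr_ge0 => i _; rewrite mulr_ge0 ?expR_ge0 ?ltW.
Qed.

(** The defect in the weighted Cauchy-Schwarz inequality, as an explicit sum over pairs. *)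
Lemma Lagrange_identity (a b : 'I_n -> R) :
  (\sum_i q i * a i ^+ 2) * (\sum_i q i * b i ^+ 2) - (\sum_i q i * (a i * b i)) ^+ 2 =
  (\sum_i \sum_j q i * q j * (a i * b j - a j * b i) ^+ 2) / 2.
Proof.
have -> : \sum_i \sum_j q i * q j * (a i * b j - a j * b i) ^+ 2 =
    (\sum_i q i * a i ^+ 2) * (\sum_i q i * b i ^+ 2)
    + (\sum_i q i * b i ^+ 2) * (\sum_i q i * a i ^+ 2)
    - 2 * ((\sum_i q i * (a i * b i)) * (\sum_i q i * (a i * b i))).
  rewrite !mulr_suml mulr_sumr -big_split/= -sumrB; apply: eq_bigr => i _.
  rewrite !mulr_sumr -big_split/= -sumrB; apply: eq_bigr => j _; ring.
by field.
Qed.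

(** The numerator bounds the exponentials below, [expR B ^+ 2] bounds the product of the two
    partition sums, and [rq ^+ 2] comes from [q i * q j >= (rq * n)^-2]. *)
Definition lse_curv (B rq : R) : R := expR (- B) ^+ 2 / expR B ^+ 2 / rq ^+ 2.

(** Converts the sum over pairs of Lagrange's identity into the centered sum of squares that the
    sample covariance measures. *)
Lemma sum_sqr_diff (w : 'I_n -> R) : (0 < n)%N ->
  \sum_i \sum_j (w i - w j) ^+ 2 =
  2 * n%:R * \sum_i (w i - n%:R^-1 * \sum_j w j) ^+ 2.
Proof.
move=> n0; have np : n%:R != 0 :> R by rewrite gt_eqF// ltr0n.
set m := n%:R^-1 * _; pose z i := w i - m.
have z0 : \sum_i z i = 0.
  by rewrite sumrB sumr_ord /m mulrA divff// mul1r subrr.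
have -> : \sum_i \sum_j (w i - w j) ^+ 2 =
    \sum_i (n%:R * z i ^+ 2 + \sum_j z j ^+ 2 - 2 * z i * \sum_j z j).
  apply: eq_bigr => i _; rewrite -sumr_ord mulr_sumr -big_split/= -sumrB.
  by apply: eq_bigr => j _; rewrite /z; ring.
rewrite z0; under eq_bigr do rewrite mulr0 subr0.
by rewrite big_split/= -mulr_sumr sumr_ord /z; ring.
Qed.

(** For [a i = e^(s i / 2)] and [b i = e^(t i / 2)], the gap [Zs * Zt - Zm ^+ 2] is exactly the
    defect of Lagrange's identity. The difference [w] is a separate argument so that it can be given
    as one inner product. *)
Lemma lse_midpoint (B : R) (s t w : 'I_n -> R) : (0 < n)%N ->
  (forall i, w i = t i - s i) ->
  (forall i, `|s i| <= B) -> (forall i, `|t i| <= B) ->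
  ln (\sum_i q i * expR ((s i + t i) / 2)) <=
  (ln (\sum_i q i * expR (s i)) + ln (\sum_i q i * expR (t i))) / 2
  - lse_curv B (max_min_ratio q) / n%:R *
     (\sum_i (w i - n%:R^-1 * \sum_j w j) ^+ 2) / 8.
Proof.
move=> n0 wE sB tB; set rq := max_min_ratio q.
have np : 0 < n%:R :> R by rewrite ltr0n.
have rq0 : 0 < rq.
  by have [+ _ _] := max_min_ratio_bounds (Ordinal n0) q_prob; apply: lt_le_trans.
pose a i := expR (s i / 2); pose b i := expR (t i / 2).
have Ea i : expR (s i) = a i ^+ 2 by rewrite -expRM_natl; congr expR; field.
have Eb i : expR (t i) = b i ^+ 2 by rewrite -expRM_natl; congr expR; field.
have Eab i j : a i * b j = expR ((s i + t j) / 2).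
  by rewrite -expRD; congr expR; field.
have sB' i : - B <= s i <= B by rewrite -ler_norml.
have tB' i : - B <= t i <= B by rewrite -ler_norml.
set Zs := \sum_i q i * expR (s i); set Zt := \sum_i q i * expR (t i).
set Zm := \sum_i q i * expR ((s i + t i) / 2).
have Zs0 : 0 < Zs by exact: wsum_exp_gt0.
have Zt0 : 0 < Zt by exact: wsum_exp_gt0.
have Zm0 : 0 < Zm by exact: wsum_exp_gt0.
pose V := \sum_i (w i - n%:R^-1 * \sum_j w j) ^+ 2.
have V0 : 0 <= V by apply: sumr_ge0 => i _; exact: sqr_ge0.
have XB : Zs * Zt <= expR B ^+ 2.
  rewrite expr2 ler_pM ?(ltW Zs0) ?(ltW Zt0)//; apply: wsum_le => i; rewrite ler_expR.
    by case/andP: (sB' i).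
  by case/andP: (tB' i).
have gap : expR (- B) ^+ 2 / rq ^+ 2 / n%:R * V / 4 <= Zs * Zt - Zm ^+ 2.
  rewrite (_ : Zs * Zt - Zm ^+ 2 =
      (\sum_i \sum_j q i * q j * (a i * b j - a j * b i) ^+ 2) / 2); last first.
    rewrite -Lagrange_identity /Zs /Zt /Zm; under eq_bigr do rewrite Ea.
    congr (_ * _ - _ ^+ 2); first by apply: eq_bigr => i _; rewrite Eb.
    by apply: eq_bigr => i _; rewrite Eab.
  have -> : expR (- B) ^+ 2 / rq ^+ 2 / n%:R * V / 4 =
      (\sum_i \sum_j ((rq * n%:R)^-1 ^+ 2 * (expR (- B) ^+ 2 / 4)) * (w i - w j) ^+ 2) / 2.
    under eq_bigr do rewrite -mulr_sumr.
    rewrite -mulr_sumr sum_sqr_diff// -/V; field.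
    by rewrite !gt_eqF.
  rewrite ler_pM2r ?invr_gt0//; apply: ler_sum => i _; apply: ler_sum => j _.
  rewrite -mulrA; apply: ler_pM; first exact: sqr_ge0.
  - by rewrite mulr_ge0 ?sqr_ge0// divr_ge0// sqr_ge0.
  - have qge l : (rq * n%:R)^-1 <= q l.
      have [_ _ +] := max_min_ratio_bounds l q_prob; rewrite -/rq mulrA => h.
      by rewrite -[leLHS]mulr1 ler_pdivrMl// mulr_gt0.
    by rewrite expr2 ler_pM// invr_ge0 mulr_ge0 ?ltW.
  (* The two products are exponentials whose exponents differ by [(w j - w i) / 2]. *)
  rewrite (_ : expR (- B) ^+ 2 / 4 * (w i - w j) ^+ 2 =
      (expR (- B) * `|(s i + t j) / 2 - (s j + t i) / 2|) ^+ 2); last first.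
    by rewrite exprMn real_normK ?num_real// !wE; field.
  rewrite !Eab -[leRHS]real_normK ?num_real// ler_sqr ?nnegrE ?mulr_ge0 ?expR_ge0//.
  by apply: expR_lip_ge; have := sB' i; have := sB' j; have := tB' i; have := tB' j; lra.
have := ln_gap (mulr_gt0 Zs0 Zt0) (exprn_gt0 2 Zm0).
rewrite lnM ?posrE// lnXn// -[_ *+ 2]mulr_natr.
suff : lse_curv B rq / n%:R * V / 4 <= 1 - Zm ^+ 2 / (Zs * Zt) by rewrite /V; lra.
have -> : 1 - Zm ^+ 2 / (Zs * Zt) = (Zs * Zt - Zm ^+ 2) / (Zs * Zt).
  by field; rewrite !gt_eqF.
rewrite /lse_curv (_ : _ / _ = expR (- B) ^+ 2 / rq ^+ 2 / n%:R * V / 4 * (expR B ^+ 2)^-1).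
  apply: ler_pM => //.
  - by rewrite divr_ge0// mulr_ge0// divr_ge0 ?(ltW np)// divr_ge0// sqr_ge0.
  - by rewrite lef_pV2 ?posrE ?mulr_gt0 ?exprn_gt0 ?expR_gt0.
by ring.
Qed.

(** A second difference splits into a product of two first differences plus a difference of
    increments, so it is small in [H] and in [d] at once. *)
Lemma expR_mixed_diff (B r H d a a' c c' : R) : 0 <= B -> 0 <= r -> 0 <= H -> 0 <= d ->
  `|a| <= B -> `|a'| <= B -> `|c| <= B -> `|c'| <= B ->
  `|a - c| <= r * d -> `|a' - a| <= H -> `|(a' - a) - (c' - c)| <= H * d ->
  `|expR a' - expR a - (expR c' - expR c)| <= expR B ^+ 3 * (1 + r) * H * d.
Proof.
move=> B0 r0 H0 d0 /[1!ler_norml] /andP[a1 a2] /[1!ler_norml] /andP[a'1 a'2].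
move=> /[1!ler_norml] /andP[c1 c2] /[1!ler_norml] /andP[c'1 c'2] ac a'a h.
have e0 := expR_ge0 B.
have -> : expR a' - expR a - (expR c' - expR c) =
    (expR a - expR c) * (expR (a' - a) - expR 0) +
    expR c * (expR (a' - a) - expR (c' - c)).
  rewrite expR0 !mulrBr !mulrBl -!expRD !mulr1 subrKC.
  by rewrite subrKC; ring.
have E2 : expR (B + B) = expR B ^+ 2 by rewrite expRD.
have h1 : `|expR a - expR c| <= expR B * (r * d).
  by apply: le_trans (expR_lip_le a2 c2) _; rewrite ler_wpM2l.
have h2 : `|expR (a' - a) - expR 0| <= expR B ^+ 2 * H.
  rewrite -E2; apply: le_trans (@expR_lip_le _ (B + B) _ _ _ _) _; try lra.
  by rewrite subr0 ler_wpM2l ?expR_ge0.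
have h3 : `|expR (a' - a) - expR (c' - c)| <= expR B ^+ 2 * (H * d).
  rewrite -E2; apply: le_trans (@expR_lip_le _ (B + B) _ _ _ _) _; try lra.
  by rewrite ler_wpM2l ?expR_ge0.
have h4 : `|expR c| <= expR B by rewrite ger0_norm ?expR_ge0// ler_expR.
apply: le_trans (ler_normD _ _) _; rewrite !normrM.
have := ler_pM (normr_ge0 _) (normr_ge0 _) h1 h2.
have := ler_pM (normr_ge0 _) (normr_ge0 _) h4 h3.
lra.
Qed.

(** The four logarithms combine into [ln (P / Q) <= P / Q - 1]. Here [P - Q] costs [e^(4B)] and
    [Q >= e^(-2B)], whence the sixth power. *)
Lemma lse_mixed_diff (B r H : R) (d a a' c c' : 'I_n -> R) : (0 < n)%N ->
  0 <= B -> 0 <= r -> 0 <= H -> (forall i, 0 <= d i) ->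
  (forall i, `|a i| <= B) -> (forall i, `|a' i| <= B) ->
  (forall i, `|c i| <= B) -> (forall i, `|c' i| <= B) ->
  (forall i, `|a i - c i| <= r * d i) ->
  (forall i, `|a' i - a i| <= H) -> (forall i, `|c' i - c i| <= H) ->
  (forall i, `|(a' i - a i) - (c' i - c i)| <= H * d i) ->
  (ln (\sum_i q i * expR (a' i)) - ln (\sum_i q i * expR (c' i)))
  - (ln (\sum_i q i * expR (a i)) - ln (\sum_i q i * expR (c i))) <=
  2 * expR B ^+ 6 * (1 + r) * H * \sum_i q i * d i.
Proof.
move=> n0 B0 r0 H0 d0 aB a'B cB c'B ac a'a c'c mix.
pose Z (e : 'I_n -> R) := \sum_i q i * expR (e i); rewrite -!/(Z _).
have Zp e : 0 < Z e by exact: wsum_exp_gt0.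
have Zlo e : (forall i, `|e i| <= B) -> expR (- B) <= Z e.
  by move=> eB; apply: wsum_ge => i; rewrite ler_expR; have := eB i; rewrite ler_norml => /andP[].
have Zhi e : (forall i, `|e i| <= B) -> Z e <= expR B.
  by move=> eB; apply: wsum_le => i; rewrite ler_expR; have := eB i; rewrite ler_norml => /andP[].
have leB (e : 'I_n -> R) : (forall i, `|e i| <= B) -> forall i, e i <= B.
  by move=> eB i; exact: le_trans (ler_norm _) (eB i).
set S := \sum_i q i * d i.
have S0 : 0 <= S by apply: sumr_ge0 => i _; rewrite mulr_ge0// ltW.
have e0 := expR_ge0 B.
have dZ' : `|Z c' - Z c| <= expR B * H.
  rewrite /Z -sumrB (le_trans (ler_norm_sum _ _ _))//.
  under eq_bigr do rewrite -mulrBr normrM ger0_norm ?(ltW (q0 _))//.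
  apply: wsum_le => i; apply: le_trans (expR_lip_le (leB _ c'B i) (leB _ cB i)) _.
  by rewrite ler_wpM2l.
have ZZ : `|Z c - Z a| <= expR B * r * S.
  rewrite /Z -sumrB (le_trans (ler_norm_sum _ _ _))// mulr_sumr.
  apply: ler_sum => i _; rewrite -mulrBr normrM ger0_norm ?(ltW (q0 _))//.
  rewrite mulrCA ler_wpM2l ?(ltW (q0 _))// -mulrA.
  apply: le_trans (expR_lip_le (leB _ cB i) (leB _ aB i)) _.
  by rewrite ler_wpM2l// distrC.
have mZ : `|Z a' - Z a - (Z c' - Z c)| <= expR B ^+ 3 * (1 + r) * H * S.
  rewrite /Z -!sumrB (le_trans (ler_norm_sum _ _ _))// mulr_sumr.
  apply: ler_sum => i _; rewrite -!mulrBr normrM ger0_norm ?(ltW (q0 _))//.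
  rewrite mulrCA ler_wpM2l ?(ltW (q0 _))//.
  exact: expR_mixed_diff.
have := ln_le_subr1 (divr_gt0 (mulr_gt0 (Zp a') (Zp c)) (mulr_gt0 (Zp a) (Zp c'))).
rewrite ln_div ?posrE ?mulr_gt0// !lnM ?posrE//.
set P := Z a' * Z c; set Q := Z a * Z c'; move=> h.
have Q0 : 0 < Q by rewrite mulr_gt0.
suff : P / Q - 1 <= 2 * expR B ^+ 6 * (1 + r) * H * S by lra.
rewrite (_ : P / Q - 1 = (P - Q) / Q); last by field; rewrite gt_eqF.
have PQ : P - Q = (Z a' - Z a - (Z c' - Z c)) * Z c + (Z c' - Z c) * (Z c - Z a).
  by rewrite /P /Q; ring.
have PQle : P - Q <= 2 * expR B ^+ 4 * (1 + r) * H * S.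
  rewrite PQ; apply: le_trans (ler_norm _) _; apply: le_trans (ler_normD _ _) _.
  rewrite !normrM.
  have Zc : `|Z c| <= expR B by rewrite ger0_norm ?Zhi// ltW.
  have h1 := ler_pM (normr_ge0 _) (normr_ge0 _) mZ Zc.
  have h2 := ler_pM (normr_ge0 _) (normr_ge0 _) dZ' ZZ.
  have e1 : 1 <= expR B by rewrite -expR0 ler_expR.
  have e24 : expR B ^+ 2 <= expR B ^+ 4 by rewrite ler_weXn2l.
  have HS : 0 <= H * S by rewrite mulr_ge0.
  have h3 : expR B ^+ 2 * (r * (H * S)) <= expR B ^+ 4 * (r * (H * S)).
    by rewrite ler_wpM2r// mulr_ge0.
  have h4 : 0 <= expR B ^+ 4 * (H * S) by rewrite mulr_ge0// exprn_ge0.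
  lra.
rewrite ler_pdivrMr// (le_trans PQle)//.
have Qlo : expR (- B) ^+ 2 <= Q.
  by rewrite expr2 /Q ler_pM ?expR_ge0// Zlo.
have -> : 2 * expR B ^+ 4 * (1 + r) * H * S =
    2 * expR B ^+ 6 * (1 + r) * H * S * expR (- B) ^+ 2.
  by rewrite expRN; field; rewrite gt_eqF ?expR_gt0.
by rewrite ler_wpM2l// !mulr_ge0 ?exprn_ge0 ?addr_ge0.
Qed.

End Weighted.

End LogSumExp.

(** * Balance vectors and the entropy balancing objective *)

Section EntropyBalancing.
Context {R : realType}.

Lemma norm_diff_bool (a b : bool) : `|a%:R - b%:R| <= 1 :> R.
Proof.
by case: a; case: b; rewrite /= ?subrr ?subr0 ?sub0r ?normr0 ?normrN1 ?normr1 ?ler01.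
Qed.

Lemma group_sizeE n p (D : dataset R n p) a :
  (group_size D a)%:R = \sum_i (treatment D i == a)%:R :> R.
Proof.
rewrite /group_size -sum1_card natr_sum big_mkcond; apply: eq_bigr => i _.
by rewrite inE; case: eqP.
Qed.

Lemma group_size_le n p (D : dataset R n p) a : (group_size D a <= n)%N.
Proof. by rewrite -[leqRHS](card_ord n) max_card. Qed.

Lemma group_size_diff n p (D D' : dataset R n p) a : differ_at_one_point D D' ->
  `|(group_size D a)%:R - (group_size D' a)%:R| <= 1 :> R.
Proof.
move=> [k [_ DD']]; rewrite !group_sizeE -sumrB (sum_one_point (k := k)).
  exact: norm_diff_bool.
by move=> i /DD'; rewrite /treatment => ->; rewrite subrr.
Qed.

(** Each of the two nonempty groups contributes total mass 1. *)
Lemma sum_inv_group_size n p (D : dataset R n p) :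
  (forall a, (1 <= group_size D a)%N) ->
  \sum_i (group_size D (treatment D i))%:R^-1 = 2 :> R.
Proof.
move=> D1.
have -> : \sum_i (group_size D (treatment D i))%:R^-1 =
    \sum_i ((treatment D i == true)%:R / (group_size D true)%:R +
      (treatment D i == false)%:R / (group_size D false)%:R) :> R.
  apply: eq_bigr => i _; case: (treatment D i); rewrite /= ?mul1r ?mul0r ?addr0 ?add0r//.
have gp a : (group_size D a)%:R != 0 :> R by rewrite pnatr_eq0 -lt0n.
by rewrite big_split/= -!mulr_suml -!group_sizeE !divff.
Qed.

Lemma dot_lrsubmx m (u : 'rV[R]_(m + m)) (v : 'rV[R]_m) :
  dot (lsubmx u + rsubmx u) v = dot u (row_mx v v).
Proof. by rewrite dotDl dot_row_mx. Qed.

(** The balance vector without its scale [n / n_a]; at a shared point it is the same for both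
    datasets. *)
Definition balance_base k (t : bool) (z : 'rV[R]_k.+1) : 'rV[R]_(k.+1 + k.+1) :=
  if t then row_mx 0 z else row_mx z 0.

Lemma balance_vectorE n p k (g : 'rV[R]_p -> 'rV[R]_k.+1) (D : dataset R n p) i :
  balance_vector g D i = (n%:R / (group_size D (treatment D i))%:R) *:
    balance_base (treatment D i) (g (covariate D i)).
Proof. by rewrite /balance_vector /balance_base; case: treatment. Qed.

Lemma norm2_balance_base k t (z : 'rV[R]_k.+1) : norm2 (balance_base t z) = norm2 z.
Proof.
apply/eqP; rewrite -(eqrXn2 (_ : 0 < 2)%N) ?norm2_ge0// /balance_base.
by case: t; rewrite norm2_row_mx norm20 expr0n ?add0r ?addr0.
Qed.

(** The scale [n / n_a] is at least 1, so the normalization of the balance vectors passes to [g]. *)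
Lemma norm2_balance_function n p k (g : 'rV[R]_p -> 'rV[R]_k.+1) (D : dataset R n p) i :
  (forall a, (1 <= group_size D a)%N) -> norm2 (balance_vector g D i) <= 1 ->
  norm2 (g (covariate D i)) <= 1.
Proof.
move=> D1; rewrite balance_vectorE norm2Z norm2_balance_base ger0_norm ?divr_ge0//.
apply: le_trans; rewrite ler_peMl ?norm2_ge0// ler_pdivlMr ?ltr0n//.
by rewrite mul1r ler_nat group_size_le.
Qed.

(** A shared point only sees its scale change, by a relative amount of at most 1/n_a, in total 2;
    the replaced point adds another 2. *)
Lemma sum_balance_vector_diff n p k (g : 'rV[R]_p -> 'rV[R]_k.+1)
    (D D' : dataset R n p) :
  (forall a, (1 <= group_size D a)%N) -> (forall a, (1 <= group_size D' a)%N) ->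
  (forall i, norm2 (balance_vector g D i) <= 1) ->
  (forall i, norm2 (balance_vector g D' i) <= 1) ->
  differ_at_one_point D D' ->
  \sum_i norm2 (balance_vector g D i - balance_vector g D' i) <= 4.
Proof.
move=> D1 D'1 Db D'b one; have [k0 [_ DD']] := one.
have bnd i : norm2 (balance_vector g D i - balance_vector g D' i) <=
    (group_size D (treatment D i))%:R^-1 + (i == k0)%:R * 2.
  have [_|ik] := eqVneq i k0.
    rewrite mul1r (le_trans (norm2B _ _))// ler_wpDl ?invr_ge0//.
    by have := Db i; have := D'b i; lra.
  rewrite mul0r addr0.
  have -> : balance_vector g D i - balance_vector g D' i =
      (((group_size D' (treatment D i))%:R - (group_size D (treatment D i))%:R)
        / (group_size D (treatment D i))%:R) *: balance_vector g D' i.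
    rewrite !balance_vectorE /treatment /covariate -(DD' i ik) scalerA -scalerBl.
    congr (_ *: _); field.
    by rewrite !pnatr_eq0 -!lt0n D1 D'1.
  rewrite norm2Z normrM [X in _ * X * _]ger0_norm ?invr_ge0//.
  have h := group_size_diff (treatment D i) one; rewrite distrC in h.
  rewrite -[leRHS]mul1r -[leRHS]mulr1 ler_pM ?mulr_ge0 ?norm2_ge0 ?invr_ge0//.
  by rewrite ler_wpM2r ?invr_ge0.
apply: le_trans (ler_sum _ (fun i _ => bnd i)) _.
rewrite big_split/= sum_inv_group_size// (sum_one_point (k := k0)).
  by rewrite eqxx mul1r; lra.
by move=> i /negbTE ->; rewrite mul0r.
Qed.

Lemma norm2_sample_mean n d (v : 'I_n -> 'rV[R]_d) c : (0 < n)%N ->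
  (forall i, norm2 (v i) <= c) -> norm2 (sample_mean v) <= c.
Proof.
move=> n0 vc; rewrite /sample_mean norm2Z ger0_norm ?invr_ge0//.
rewrite ler_pdivrMl ?ltr0n// (le_trans (norm2_sum _))// -sumr_ord.
exact: ler_sum.
Qed.

Lemma dot_sample_mean n d (v : 'I_n -> 'rV[R]_d) u :
  dot u (sample_mean v) = n%:R^-1 * \sum_i dot u (v i).
Proof. by rewrite dotZr dot_sumr. Qed.

Lemma ebw_objective_midpoint n p k (g : 'rV[R]_p -> 'rV[R]_k.+1) q (reg : R)
    (D : dataset R n p) (u v : 'rV[R]_(k.+1 + k.+1)) r :
  (0 < n)%N -> positive_probability q ->
  (forall i, norm2 (balance_vector g D i) <= 1) ->
  norm2 u <= r -> norm2 v <= r ->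
  - ebw_objective g q reg D (2^-1 *: (u + v)) <=
  (- ebw_objective g q reg D u + - ebw_objective g q reg D v) / 2 -
  (lse_curv r (max_min_ratio q) / n%:R *
    (\sum_i dot (balance_vector g D i - sample_mean (balance_vector g D)) (v - u) ^+ 2)
    + reg * norm2 (v - u) ^+ 2) / 8.
Proof.
move=> n0 qp Db ur vr; set b := balance_vector g D; rewrite /ebw_objective norm2_midpoint !dot_lrsubmx.
have bnd w i : norm2 w <= r -> `|dot w (b i)| <= r.
  by move=> wr; rewrite -[leRHS]mulr1; exact: dot_bound.
have /= := @lse_midpoint R n q qp r (fun i => dot u (b i)) (fun i => dot v (b i))
  (fun i => dot (v - u) (b i)) n0 (fun i => dotBl v u (b i))
  (fun i => bnd u i ur) (fun i => bnd v i vr).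
rewrite -dot_sample_mean => main.
have EV : \sum_i dot (b i - sample_mean b) (v - u) ^+ 2 =
    \sum_i (dot (v - u) (b i) - dot (v - u) (sample_mean b)) ^+ 2.
  by apply: eq_bigr => i _; rewrite -dotBr dotC.
have EZ : \sum_i q i * expR (dot (2^-1 *: (u + v)) (b i)) =
    \sum_i q i * expR ((dot u (b i) + dot v (b i)) / 2).
  by apply: eq_bigr => i _; rewrite dotZl dotDl [2^-1 * _]mulrC.
rewrite EV EZ dotZl dotDl; lra.
Qed.

(** Log-sum-exp contributes through weights [q i <= rq / n] against a total change 4 of the balance
    vectors; the additional 4 comes from the mean of [g]. *)
Lemma ebw_objective_diff n p k (g : 'rV[R]_p -> 'rV[R]_k.+1) q (reg : R)
    (D D' : dataset R n p) (u v : 'rV[R]_(k.+1 + k.+1)) r :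
  positive_probability q ->
  (forall a, (1 <= group_size D a)%N) -> (forall a, (1 <= group_size D' a)%N) ->
  (forall i, norm2 (balance_vector g D i) <= 1) ->
  (forall i, norm2 (balance_vector g D' i) <= 1) ->
  norm2 u <= r -> norm2 v <= r ->
  differ_at_one_point D D' ->
  (- ebw_objective g q reg D v - - ebw_objective g q reg D' v) -
  (- ebw_objective g q reg D u - - ebw_objective g q reg D' u) <=
  (8 * expR r ^+ 6 * (1 + r) * max_min_ratio q + 4) / n%:R * norm2 (v - u).
Proof.
move=> qp D1 D'1 Db D'b ur vr one; have n0 := one_point_size one.
have np : 0 < n%:R :> R by rewrite ltr0n.
have r0 : 0 <= r by exact: le_trans (norm2_ge0 u) ur.
rewrite /ebw_objective !dot_lrsubmx.
set b := balance_vector g D; set b' := balance_vector g D'.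
set m := sample_mean _; set m' := sample_mean _.
have bnd w i : norm2 w <= r -> `|dot w (b i)| <= r.
  by move=> wr; rewrite -[leRHS]mulr1; exact: dot_bound.
have bnd' w i : norm2 w <= r -> `|dot w (b' i)| <= r.
  by move=> wr; rewrite -[leRHS]mulr1; exact: dot_bound.
set H := norm2 (v - u); have H0 : 0 <= H by exact: norm2_ge0.
have lin : - dot (v - u) (row_mx m m - row_mx m' m') <= 4 / n%:R * H.
  have [k0 [_ DD']] := one.
  have mm : norm2 (m - m') <= 2 / n%:R.
    rewrite -scalerBr -sumrB (bigD1 k0)//= big1 ?addr0; last first.
      by move=> i ik; rewrite /covariate DD'// subrr.
    rewrite norm2Z ger0_norm ?invr_ge0// mulrC ler_wpM2r ?invr_ge0//.
    rewrite (le_trans (norm2B _ _))//.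
    have := norm2_balance_function D1 (Db k0).
    have := norm2_balance_function D'1 (D'b k0); lra.
  (* Repeating [m - m'] in both blocks costs a factor [sqrt 2], rounded up to 2. *)
  have rr : norm2 (row_mx m m - row_mx m' m') <= 4 / n%:R.
    rewrite opp_row_mx add_row_mx -ler_sqr ?nnegrE ?norm2_ge0 ?divr_ge0//.
    rewrite norm2_row_mx.
    have : norm2 (m - m') ^+ 2 <= (2 / n%:R) ^+ 2.
      by rewrite ler_sqr ?nnegrE ?norm2_ge0 ?divr_ge0.
    rewrite !exprMn; have := sqr_ge0 (n%:R^-1 : R); lra.
  have := dot_bound (lexx H) rr; rewrite ler_norml => /andP[+ _]; lra.
pose d i := norm2 (b i - b' i).
have := @lse_mixed_diff R n q qp r r H d (fun i => dot u (b i)) (fun i => dot v (b i))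
  (fun i => dot u (b' i)) (fun i => dot v (b' i)) n0 r0 r0 H0
  (fun i => norm2_ge0 _) (fun i => bnd u i ur) (fun i => bnd v i vr)
  (fun i => bnd' u i ur) (fun i => bnd' v i vr).
have h1 i : `|dot u (b i) - dot u (b' i)| <= r * d i.
  by rewrite -dotBr dot_bound.
have h2 i : `|dot v (b i) - dot u (b i)| <= H.
  by rewrite -dotBl -[leRHS]mulr1 dot_bound.
have h3 i : `|dot v (b' i) - dot u (b' i)| <= H.
  by rewrite -dotBl -[leRHS]mulr1 dot_bound.
have h4 i : `|dot v (b i) - dot u (b i) - (dot v (b' i) - dot u (b' i))| <= H * d i.
  by rewrite -!dotBl -dotBr dot_bound.
move=> /(_ h1 h2 h3 h4) main.
have qd : \sum_i q i * d i <= max_min_ratio q / n%:R * 4.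
  apply: (@le_trans _ _ (\sum_i max_min_ratio q / n%:R * d i)).
    apply: ler_sum => i _; rewrite ler_wpM2r ?norm2_ge0// ler_pdivlMr// mulrC.
    by have [] := max_min_ratio_bounds i qp.
  rewrite -mulr_sumr ler_wpM2l ?sum_balance_vector_diff// divr_ge0//.
  have [+ _ _] := max_min_ratio_bounds (Ordinal n0) qp.
  exact: le_trans.
have : 2 * expR r ^+ 6 * (1 + r) * H * (\sum_i q i * d i) <=
    2 * expR r ^+ 6 * (1 + r) * H * (max_min_ratio q / n%:R * 4).
  by rewrite ler_wpM2l// mulr_ge0// mulr_ge0 ?addr_ge0// mulr_ge0// exprn_ge0 ?expR_ge0.
rewrite dotBl !dotBr in lin; lra.
Qed.

(** The linear term accounts for 2 and the log-sum-exp, which is at least [- norm2 u], for 1. *)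
Lemma ebw_objective0 n p k (g : 'rV[R]_p -> 'rV[R]_k.+1) q (reg : R)
    (D : dataset R n p) (u : 'rV[R]_(k.+1 + k.+1)) :
  (0 < n)%N -> 0 <= reg -> positive_probability q ->
  (forall a, (1 <= group_size D a)%N) ->
  (forall i, norm2 (balance_vector g D i) <= 1) ->
  - ebw_objective g q reg D 0 - - ebw_objective g q reg D u <= 3 * norm2 u.
Proof.
move=> n0 reg0 qp D1 Db; rewrite /ebw_objective !dot_lrsubmx norm20 expr0n mulr0 dot0l.
under eq_bigr do rewrite dot0l expR0 mulr1.
have [_ ->] := qp; rewrite ln1; set m := sample_mean _.
have m1 : norm2 m <= 1.
  by apply: norm2_sample_mean => // i; exact: norm2_balance_function.
have mm : norm2 (row_mx m m) <= 2.
  rewrite -ler_sqr ?nnegrE ?norm2_ge0// norm2_row_mx.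
  have : norm2 m ^+ 2 <= 1 ^+ 2 by rewrite ler_sqr ?nnegrE ?norm2_ge0.
  by rewrite expr1n; lra.
have h := dot_bound (lexx (norm2 u)) mm.
have := le_trans (ler_norm _) h.
have Z : - norm2 u <= ln (\sum_i q i * expR (dot u (balance_vector g D i))).
  rewrite -[leLHS]expRK ler_ln ?posrE ?expR_gt0 ?wsum_exp_gt0//.
  apply: wsum_ge => // i; rewrite ler_expR.
  have := dot_bound (lexx (norm2 u)) (Db i); rewrite mulr1 ler_norml.
  by case/andP.
have := mulr_ge0 reg0 (sqr_ge0 (norm2 u)); lra.
Qed.

End EntropyBalancing.

(** * Stability of the entropy balancing estimate and weights *)

Section EntropyBalancingStability.
Context {R : realType}.

Lemma lse_curv_bounds (B rq : R) : 0 <= B -> 1 <= rq -> 0 < lse_curv B rq <= 1.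
Proof.
move=> B0 rq1; have rq0 : 0 < rq by exact: lt_le_trans rq1.
rewrite /lse_curv !divr_gt0 ?exprn_gt0 ?expR_gt0//= ler_pdivrMr ?exprn_gt0// mul1r.
apply: (@le_trans _ _ 1); last by rewrite exprn_ege1.
rewrite ler_pdivrMr ?exprn_gt0 ?expR_gt0// mul1r ler_sqr ?nnegrE ?expR_ge0//.
by rewrite ler_expR; lra.
Qed.

Lemma sample_covariance_ge0 n d (x : 'I_n -> 'rV[R]_d) : 0 <= lambda_min (sample_covariance x).
Proof.
apply: lambda_min_ge0 => u.
rewrite (dot_gram n%:R^-1 (fun i => x i - sample_mean x)) mulr_ge0 ?invr_ge0//.
by apply: sumr_ge0 => i _; rewrite sqr_ge0.
Qed.

(** The constant of [ebw_objective_diff] times the 4 of the midpoint argument; being at least 16, it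
    also covers the [4 * 3] of the comparison with 0. *)
Definition ebw_slope (r rq : R) : R := 4 * (8 * expR r ^+ 6 * (1 + r) * rq + 4).

Lemma ebw_estimate_close n p k (g : 'rV[R]_p -> 'rV[R]_k.+1) q (reg : R)
    (D D' : dataset R n p) (u v : 'rV[R]_(k.+1 + k.+1)) r rq :
  positive_probability q -> max_min_ratio q = rq -> 0 <= reg ->
  ebw_assumptions g rq r reg D -> ebw_assumptions g rq r reg D' ->
  ebw_estimate g q r reg D u -> ebw_estimate g q r reg D' v ->
  differ_at_one_point D D' ->
  \sum_i dot (balance_vector g D i - sample_mean (balance_vector g D)) (v - u) ^+ 2
    + (norm2 u + norm2 v) ^+ 2 <=
  decay_const (lse_curv r rq) (ebw_slope r rq) (2 ^+ 2) r *
  Num.min 1 (1 / (lambda_min (sample_covariance (balance_vector g D)) + reg)) ^+ 2.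
Proof.
move=> qp qrq reg0 [D1 Db mu0] [D'1 D'b _] uD vD' one.
have n0 := one_point_size one.
have np : 0 < n%:R :> R by rewrite ltr0n.
have [rq1 _ _] := max_min_ratio_bounds (Ordinal n0) qp; rewrite qrq in rq1.
have [ur uF] := uD; have [vr vF] := vD'; rewrite /ball2/= in ur vr.
have r0 : 0 <= r by exact: le_trans (norm2_ge0 u) ur.
have /andP[k0 k1] := lse_curv_bounds r0 rq1.
set c := lse_curv r rq in k0 k1 *; set l := lambda_min _ in mu0 *.
have l0 : 0 <= l by exact: sample_covariance_ge0.
have uA : argmin (@ball2 R _ r) (fun w => - ebw_objective g q reg D w) u.
  by split=> // w wr; rewrite lerN2 uF.
have step w : norm2 w <= r ->
    c / n%:R * (\sum_i dot (balance_vector g D i - sample_mean (balance_vector g D)) (w - u) ^+ 2)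
    + reg * norm2 (w - u) ^+ 2
    <= 4 * (- ebw_objective g q reg D w - - ebw_objective g q reg D u).
  move=> wr; have := argmin_midpoint uA (ball2_midpoint ur wr)
    (ebw_objective_midpoint reg n0 qp Db ur wr).
  by rewrite qrq -/c; lra.
have gap w := @lambda_min_gram R n _
  (fun i => balance_vector g D i - sample_mean (balance_vector g D)) w n0.
have slope16 : 16 <= ebw_slope r rq.
  have : 0 <= expR r ^+ 6 * (1 + r) * rq.
    by rewrite mulr_ge0 ?(le_trans _ rq1)// mulr_ge0 ?addr_ge0// exprn_ge0 ?expR_ge0.
  rewrite /ebw_slope; lra.
apply: (@regularized_decay _ n%:R _ _ _ _ _ _ _ (norm2 (v - u))) => //.
- by rewrite ler1n.
- by rewrite k0.
- exact: le_trans slope16.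
(* If [l + reg] vanished, both nonnegative terms would, against the positivity required by
   [ebw_assumptions]. *)
- rewrite lt_neqAle addr_ge0// andbT eq_sym; apply/eqP => lreg.
  have [lz rz] : l = 0 /\ reg = 0 by split; lra.
  by rewrite lz rz mulr0 addr0 ltxx in mu0.
- by apply: sumr_ge0 => i _; rewrite sqr_ge0.
- exact: norm2_ge0.
- by rewrite norm2_ge0.
- by rewrite norm2_ge0.
- by rewrite [leRHS]addrC norm2B.
- by rewrite -{1}(subrKC u v) norm2D.
- apply: le_trans (step v vr) _.
  have := ebw_objective_diff reg qp D1 D'1 Db D'b ur vr one.
  have := vF u ur; rewrite qrq /ebw_slope; lra.
- apply: sum_sqr_dot_le => i; rewrite (le_trans (norm2B _ _))//.
  have := Db i; have := norm2_sample_mean n0 Db; lra.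
- have := step 0; rewrite norm20 sub0r norm2N => /(_ r0) h.
  have h0 := ebw_objective0 u n0 reg0 qp D1 Db.
  have := gap (- u); rewrite norm2N -mulrA -/(sample_covariance _) -/l => h'.
  have : c / n%:R * (n%:R * (l * norm2 u ^+ 2)) <= c / n%:R *
     \sum_i dot (balance_vector g D i - sample_mean (balance_vector g D)) (- u) ^+ 2.
    by rewrite ler_wpM2l// divr_ge0 ?(ltW k0)// ltW.
  rewrite [leLHS]mulrA divfK ?gt_eqF//.
  have := ler_wpM2r (norm2_ge0 u) slope16; have := norm2_ge0 u; lra.
Qed.

(* Only the centered predictors are controlled by the covariance; the weights
   being invariant under rescaling, those of D' are multiplied by
   exp(- <v - u, mean b>) before the comparison. *)
Lemma ebw_stable n p k (g : 'rV[R]_p -> 'rV[R]_k.+1) q (reg : R)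
    (D D' : dataset R n p) (u v : 'rV[R]_(k.+1 + k.+1)) r rq :
  positive_probability q -> max_min_ratio q = rq -> 0 <= reg ->
  ebw_assumptions g rq r reg D -> ebw_assumptions g rq r reg D' ->
  ebw_estimate g q r reg D u -> ebw_estimate g q r reg D' v ->
  differ_at_one_point D D' ->
  norm2 (ebw g q u D - ebw g q v D') <=
  ((expR (- (3 * r)) / rq)^-1 + rq * expR (3 * r) / (expR (- (3 * r)) / rq) ^+ 2) *
  (4 * (rq * expR (3 * r)) *
    Num.sqrt (decay_const (lse_curv r rq) (ebw_slope r rq) (2 ^+ 2) r)) *
  Num.min 1 (1 / (lambda_min (sample_covariance (balance_vector g D)) + reg)).
Proof.
move=> qp qrq reg0 aD aD' uD vD' one.
have := ebw_estimate_close qp qrq reg0 aD aD' uD vD' one.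
have n0 := one_point_size one.
have np : 0 < n%:R :> R by rewrite ltr0n.
have [D1 Db _] := aD; have [D'1 D'b _] := aD'.
have [ur _] := uD; have [vr _] := vD'; rewrite /ball2/= in ur vr.
have r0 : 0 <= r by exact: le_trans (norm2_ge0 u) ur.
have [rq1 _ _] := max_min_ratio_bounds (Ordinal n0) qp; rewrite qrq in rq1.
have rq0 : 0 < rq by exact: lt_le_trans rq1.
have /andP[k0 _] := lse_curv_bounds r0 rq1.
set c := decay_const _ _ _ _; set mn := Num.min _ _ => h.
have mn0 : 0 <= mn by rewrite le_min ler01 divr_ge0// addr_ge0// sample_covariance_ge0.
have c0 : 0 <= c.
  rewrite decay_const_ge0 ?(ltW k0)// /ebw_slope.
  have : 0 <= expR r ^+ 6 * (1 + r) * rq.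
    by rewrite mulr_ge0 ?(ltW rq0)// mulr_ge0 ?addr_ge0// exprn_ge0 ?expR_ge0.
  lra.
set b := balance_vector g D in Db h *; set b' := balance_vector g D' in D'b *.
set m := sample_mean b in h.
pose s i := dot u (b i); pose t i := dot v (b' i) - dot (v - u) m.
have bnd w i : norm2 w <= r -> `|dot w (b i)| <= r.
  by move=> wr; rewrite -[leRHS]mulr1; exact: dot_bound.
have bnd' w i : norm2 w <= r -> `|dot w (b' i)| <= r.
  by move=> wr; rewrite -[leRHS]mulr1; exact: dot_bound.
have s3 i : - (3 * r) <= s i <= 3 * r.
  by have := bnd u i ur; rewrite ler_norml /s; lra.
(* The recentering adds at most [2 * r] to the exponent, which sets the range [3 * r]. *)
have t3 i : - (3 * r) <= t i <= 3 * r.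
  have := bnd' v i vr; have m1 : norm2 m <= 1 by exact: norm2_sample_mean.
  have := dot_bound (_ : norm2 (v - u) <= 2 * r) m1.
  have -> : norm2 (v - u) <= 2 * r by have := norm2B v u; lra.
  by move=> /(_ isT); rewrite !ler_norml /t; lra.
have -> : ebw g q u D = normalized (fun i => n%:R * q i * expR (s i)).
  rewrite /ebw -(@normalizedZ R n (fun i => q i * expR (s i)) n%:R) ?gt_eqF//; congr normalized.
  by apply/funext => i; exact: mulrA.
have -> : ebw g q v D' = normalized (fun i => n%:R * q i * expR (t i)).
  rewrite /ebw -(@normalizedZ R n (fun i => q i * expR (dot v (b' i))) (n%:R * expR (- dot (v - u) m))).
    congr normalized; apply/funext => i /=; rewrite /t expRD -/b'; ring.
  by rewrite mulf_neq0 ?gt_eqF// expR_gt0.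
have wlo e i : - (3 * r) <= e <= 3 * r -> expR (- (3 * r)) / rq <= n%:R * q i * expR e.
  move=> /andP[e1 _]; have [_ _] := max_min_ratio_bounds i qp; rewrite qrq => h1.
  rewrite mulrC; apply: ler_pM; rewrite ?invr_ge0 ?expR_ge0 ?(ltW rq0)// ?ler_expR//.
  by rewrite -[leLHS]mulr1 ler_pdivrMl.
have whi i : n%:R * q i <= rq.
  by have [_ + _] := max_min_ratio_bounds i qp; rewrite qrq.
have nq0 i : 0 <= n%:R * q i by rewrite mulr_ge0// ltW//; case: qp.
rewrite -mulrA; apply: normalized_lip => //.
- by rewrite divr_gt0 ?expR_gt0.
- by rewrite mulr_ge0// mulr_ge0 ?sqrtr_ge0// mulr_ge0// mulr_ge0 ?expR_ge0// ltW.
- by move=> i; exact: wlo.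
- by move=> i; exact: wlo.
- by move=> i; rewrite ler_pM ?expR_ge0// ler_expR; case/andP: (t3 i).
pose d i := norm2 (b i - b' i).
(* As [d i <= 2], the bound on the sum of the [d i] controls their squares. *)
have d2 i : d i ^+ 2 <= 2 * d i.
  rewrite expr2 ler_wpM2r ?norm2_ge0// (le_trans (norm2B _ _))//.
  by have := Db i; have := D'b i; lra.
have dsum : \sum_i d i <= 4 by exact: sum_balance_vector_diff.
set V := \sum_i _ in h.
have V0 : 0 <= V by apply: sumr_ge0 => i _; rewrite sqr_ge0.
have bound i : (n%:R * q i * expR (s i) - n%:R * q i * expR (t i)) ^+ 2 <=
    (rq * expR (3 * r)) ^+ 2 *
      (2 * dot (b i - m) (v - u) ^+ 2 + 4 * norm2 v ^+ 2 * d i).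
  rewrite -mulrBr -[leLHS]real_normK ?num_real// normrM (ger0_norm (nq0 i)).
  have /andP[_ s3i] := s3 i; have /andP[_ t3i] := t3 i.
  apply: (@le_trans _ _ ((rq * (expR (3 * r) * `|s i - t i|)) ^+ 2)).
    rewrite ler_sqr ?nnegrE ?(mulr_ge0 (nq0 i)) ?(mulr_ge0 (ltW rq0)) ?mulr_ge0 ?expR_ge0//.
    by rewrite ler_pM// expR_lip_le.
  rewrite mulrA [leLHS]exprMn ler_wpM2l ?sqr_ge0// real_normK ?num_real//.
  (* The change of the balance vectors is paired with [v], whose norm decays, and the change of
     parameter meets only centered vectors. *)
  have -> : s i - t i = dot v (b i - b' i) - dot (b i - m) (v - u).
    by rewrite /s /t dotC !(dotBl, dotBr) !(dotC (b i)); rewrite !(dotC m); ring.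
  have h1 : dot v (b i - b' i) ^+ 2 <= norm2 v ^+ 2 * (2 * d i).
    apply: (@le_trans _ _ (norm2 v ^+ 2 * d i ^+ 2)); last by rewrite ler_wpM2l ?sqr_ge0.
    rewrite -exprMn -(real_normK (num_real (dot _ _))) ler_sqr ?nnegrE ?mulr_ge0 ?norm2_ge0//.
    exact: Cauchy_Schwarz.
  have := sqr_ge0 (dot v (b i - b' i) + dot (b i - m) (v - u)); lra.
apply: le_trans (ler_sum _ (fun i _ => bound i)) _.
rewrite -mulr_sumr big_split/= -!mulr_sumr -/V.
have v2 : norm2 v ^+ 2 <= (norm2 u + norm2 v) ^+ 2.
  by rewrite ler_sqr ?nnegrE ?addr_ge0 ?norm2_ge0// lerDr norm2_ge0.
have v0 := sqr_ge0 (norm2 v).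
have h2 : 4 * norm2 v ^+ 2 * \sum_i d i <= 4 * norm2 v ^+ 2 * 4.
  by rewrite ler_wpM2l// mulr_ge0.
have -> : (4 * (rq * expR (3 * r)) * Num.sqrt c * mn) ^+ 2 =
    (rq * expR (3 * r)) ^+ 2 * (16 * (c * mn ^+ 2)).
  by rewrite !exprMn sqr_sqrtr//; ring.
by rewrite ler_wpM2l ?sqr_ge0//; lra.
Qed.

End EntropyBalancingStability.

(** The constant must be positive for all fixed parameters, including values such as a negative
    radius, for which an explicit constant may fail to be. *)
Lemma le_bound_abs (R : realDomainType) (x y z : R) :
  0 <= z -> y <= x * z -> y <= (`|x| + 1) * z.
Proof. by move=> z0 yx; have := ler_wpM2r z0 (ler_norm x); lra. Qed.

Theorem theorem4p2 (R : realType) :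
  [/\ (* IPW, randomized trial *)
      forall p0 p1 : R, 0 < p0 < 1 -> 0 < p1 < 1 -> p0 + p1 = 1 ->
      exists2 c : R, 0 < c &
        forall (n p : nat) (D D' : dataset R n p), differ_at_one_point D D' ->
        norm2 (ipw_trial p0 p1 D - ipw_trial p0 p1 D') <= c,

      (* IPW, known regression parameter *)
      forall M Ripw : R,
      exists2 c : R, 0 < c &
        forall (n p : nat) (lam : 'rV[R]_p) (D D' : dataset R n p),
        norm2 lam <= Ripw ->
        bounded_covariates M D -> bounded_covariates M D' ->
        differ_at_one_point D D' ->
        norm2 (ipw lam D - ipw lam D') <= c,

      (* IPW, estimated regression parameter *)
      forall M Ripw : R,
      exists2 c : R, 0 < c &
        forall (n p : nat) (reg : R) (D D' : dataset R n p)
          (lam lam' : 'rV[R]_p),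
        0 <= reg ->
        bounded_covariates M D -> bounded_covariates M D' ->
        0 < lambda_min (second_moment D) -> 0 < lambda_min (second_moment D') ->
        logistic_estimate Ripw reg D lam -> logistic_estimate Ripw reg D' lam' ->
        differ_at_one_point D D' ->
        norm2 (ipw lam D - ipw lam' D')
          <= c * Num.min 1 (1 / (lambda_min (second_moment D) + reg)),

      (* MMD weights *)
      forall C Rmmd : R,
      exists2 c : R, 0 < c &
        forall (n p : nat) (K : 'rV[R]_p -> 'rV[R]_p -> R) (alpha reg : R)
          (D D' : dataset R n p) (w w' : 'rV[R]_n),
        reproducing_kernel K -> 0 <= alpha <= 1 -> 0 < reg ->
        (forall i j, `|K (covariate D i) (covariate D j)| <= C) ->
        (forall i j, `|K (covariate D' i) (covariate D' j)| <= C) ->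
        mmd_weights K alpha reg Rmmd D w ->
        mmd_weights K alpha reg Rmmd D' w' ->
        differ_at_one_point D D' ->
        norm2 (w - w') <= c * (n%:R / reg)
    & (* entropy balancing weights *)
      forall Rebw rq : R,
      exists2 c : R, 0 < c &
        forall (n p k : nat) (g : 'rV[R]_p -> 'rV[R]_k.+1) (q : 'I_n -> R)
          (reg : R) (D D' : dataset R n p) (lam lam' : 'rV[R]_(k.+1 + k.+1)),
        (forall x y, g x 0 0 = g y 0 0) ->
        positive_probability q -> max_min_ratio q = rq -> 0 <= reg ->
        ebw_assumptions g rq Rebw reg D -> ebw_assumptions g rq Rebw reg D' ->
        ebw_estimate g q Rebw reg D lam -> ebw_estimate g q Rebw reg D' lam' ->
        differ_at_one_point D D' ->
        norm2 (ebw g q lam D - ebw g q lam' D')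
          <= c * Num.min 1
               (1 / (lambda_min (sample_covariance (balance_vector g D)) + reg)) ].
Proof.
have abs1 (x : R) : 0 < `|x| + 1 by rewrite ltr_wpDl.
have min0 (l reg : R) : 0 <= l -> 0 <= reg -> 0 <= Num.min 1 (1 / (l + reg)).
  by move=> l0 reg0; rewrite le_min ler01 divr_ge0// addr_ge0.
split.
- move=> p0 p1 p0P p1P _; eexists; last by move=> n p D D'; exact: ipw_trial_stable.
  case/andP: p0P => p00 _; case/andP: p1P => p10 _.
  have : 0 < p0^-1 + p1^-1 by rewrite addr_gt0 ?invr_gt0.
  by move=> s0; rewrite mulr_gt0// addr_gt0.
- move=> M r; exists ((1 + (1 + expR (M * r))) * (1 + expR (M * r))).
    by have := expR_gt0 (M * r); move=> e0; rewrite mulr_gt0 ?addr_gt0.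
  by move=> n p lam D D'; exact: ipw_stable.
(* The constant is an existential variable created before [n], the data and [reg] are introduced, so
   it cannot depend on them. *)
- move=> M r; eexists; last first.
    move=> n p reg D D' u v reg0 DM D'M l0 _ uD vD' one.
    apply: le_bound_abs; first exact: min0 (ltW l0) reg0.
    exact: (ipw_estimated_stable reg0 DM D'M l0 uD vD' one).
  exact: abs1.
- move=> C r; eexists; last first.
    move=> n p K al reg D D' w w' hK alP reg0 KC K'C wD w'D' one.
    apply: le_bound_abs; first by rewrite divr_ge0// ltW.
    exact: (mmd_stable hK alP reg0 KC K'C wD w'D' one).
  exact: abs1.
- move=> r rq; eexists; last first.
    move=> n p k g q reg D D' u v _ qp qrq reg0 aD aD' uD vD' one.
    apply: le_bound_abs; first by apply: min0 => //; exact: sample_covariance_ge0.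
    exact: (ebw_stable qp qrq reg0 aD aD' uD vD' one).
  exact: abs1.
Qed.
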